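(* Suppose that $\phi$ is sub-additive and that $\tau_1(Y)$ is $\mathbb P^0$-integrable for every $Y\in\mathscr Y_2^\infty$. Then there exists ($\mathbb P^0$-a.s.) a unique perfect bi-infinite $\phi$-matching at even times: it coincides almost surely with the stationary perfect bi-infinite $\phi$-matching $\mathbf M^{*,-\infty}_\infty(\phi)$, and for every $Y\in\mathscr Y_2^\infty$ it is obtained as the almost sure limit, as $k\to\infty$, of the infinite matchings $\mathbf M^{\{Y,-k\}}_\infty(\phi)$ started from $Y$ at time $-k$.
   Context: Model. $G=(\mathcal V,\mathcal E)$ is a finite connected simple graph; $\mathcal E(v)$ is the set of neighbors of $v$. $\mathcal V^*$ is the set of finite words over $\mathcal V$, $|w|$ the length of $w$, $|w|_i$ the number of occurrences of $i$ in $w$, $\emptyset$ the empty word. $\mathbb W=\{w\in\mathcal V^*:|w|_i|w|_j=0\ \forall (i,j)\in\mathcal E\}$ is the set of buffer contents (classes of stored items in order of arrival), $\mathbb W_2=\{w\in\mathbb W:|w|\text{ even}\}$, $\mathbb W_2(r)=\{w\in\mathbb W_2:|w|\le 2r\}$. $\mathcal S=\prod_{i\in\mathcal V}S_{\mathcal E(i)}$ is the set of lists of preferences ($S_A$ = permutations of $A$). An admissible matching policy $\phi$ consists of a probability distribution $\nu_\phi$ on $\mathcal S$ and a map $\odot_\phi:\mathbb W\times(\mathcal V\times\mathcal S)\to\mathbb W$ such that $w\odot_\phi(v,\sigma)=wv$ if no letter of $w$ lies in $\mathcal E(v)$ (the arriving $v$-item is stored), and otherwise $w\odot_\phi(v,\sigma)$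 is $w$ with one letter belonging to $\mathcal E(v)$ deleted, the deleted position being a function of $(w,v,\sigma)$ (the arriving item is matched with the item at that position and both leave). For $z=v_1\cdots v_n$, $\varsigma=\sigma_1\cdots\sigma_n$, $W_\phi(z,\varsigma)$ is obtained from $\emptyset$ by applying successively $\odot_\phi(v_1,\sigma_1),\dots,\odot_\phi(v_n,\sigma_n)$. $\phi$ is sub-additive if $|W_\phi(z'z'',\varsigma'\varsigma'')|\le|W_\phi(z',\varsigma')|+|W_\phi(z'',\varsigma'')|$ for all $z',z''\in\mathcal V^*$ and all $\varsigma',\varsigma''\in\mathcal S^*$ with $|\varsigma'|=|z'|$, $|\varsigma''|=|z''|$ whose letters have positive $\nu_\phi$-probability. Input. $\mu$ is a probability measure on $\mathcal V$ with full support. $\Omega^0=(\mathcal V\times\mathcal S\times\mathcal V\times\mathcal S)^{\mathbb Z}$ with its product $\sigma$-algebra and $\mathbb P^0=(\mu\otimes\nu_\phi\otimes\mu\otimes\nu_\phi)^{\otimes\mathbb Z}$; $\theta$ is the shift, $(V^0,\Sigma^0,V^1,\Sigma^1)(\omega)=\omega_0$, and $(V^0_n,\Sigma^0_n,V^1_n,\Sigma^1_n)=(V^0,\Sigma^0,V^1,\Sigma^1)\circ\theta^n$: at time $n$ an item of class $V^0_n$ and then an item of class $V^1_n$ arrive. For a $\mathbb W_2$-valued r.v. $Y$, $U_0^{\{Y\}}=Y$ and $U_{n+1}^{\{Y\}}=(U_n^{\{Y\}}\odot_\phi(V^0_n,\Sigma^0_n))\odot_\phi(V^1_n,\Sigma^1_n)$,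 $n\in\mathbb N$; $\tau_1(Y)=\inf\{n>0:U_n^{\{Y\}}=\emptyset\}$. $\mathscr Y_2^\infty=\bigcup_{r\ge1}\mathscr Y_2^r$, where $\mathscr Y_2^r$ is the set of $\mathbb W_2(r)$-valued r.v.'s on $\Omega^0$. Matchings. For $m\le n$ and $Y\in\mathscr Y_2^\infty$, $\mathbf M^{\{Y,m\}}_n(\phi)$ is the random graph whose nodes are the items initially stored at time $m$ (the letters of $Y\circ\theta^m$) and the items arriving at times $m,\dots,n-1$, with an edge between two items when they are matched with each other by $\phi$ in the system started from $Y\circ\theta^m$ at time $m$. It is increasing in $n$, and $\mathbf M^{\{Y,m\}}_\infty(\phi)$ denotes the union over $n\ge m$. A matching is perfect if all its nodes have degree 1. A bi-infinite $\phi$-matching (at even times) is a graph on the set of all items arriving at times $n\in\mathbb Z$ obtained as limit of $\mathbf M^{\{Y,m\}}_\infty(\phi)$ as $m\to-\infty$, for some $Y\in\mathscr Y_2^\infty$; limits are understood as follows: for each $m_0\in\mathbb Z$, the restrictions of the matchings to items arriving from time $m_0$ onwards are eventually constant. Under the assumptions of the claim there is an a.s. unique $\mathbb W_2$-valued $U$ with $U\circ\theta=(U\odot_\phi(V^0,\Sigma^0))\odot_\phi(V^1,\Sigma^1)$ a.s.; put $U^*_n=U\circ\theta^n$. The construction points are the $n\in\mathbb Z$ with $U^*_n=\emptyset$; a.s. they form a set unbounded in both directions, enumerated increasingly as $(c^*_i)_{i\in\mathbb Z}$, and the stationary bi-infinite matching is $\mathbf M^{*,-\infty}_\infty(\phi)=\bigcup_{i\in\mathbb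 Z}\mathbf M^{\{\emptyset,c^*_i\}}_{c^*_{i+1}}(\phi)$. *)

(* Defs.v *)
(* MathComp / MathComp-Analysis *)
From HB Require Import structures.
From mathcomp Require Import all_boot all_order all_fingroup all_algebra.
From mathcomp Require Import all_classical all_reals all_analysis.

Set Implicit Arguments.
Unset Strict Implicit.
Unset Printing Implicit Defensive.

Import Order.TTheory GRing.Theory Num.Theory.
Local Open Scope classical_set_scope.
Local Open Scope ring_scope.

(* Finite connected simple graphs; connected graphs are nonempty. *)
Record cgraph := CGraph {
  vertex :> finType;
  adj : rel vertex;
  adj_sym : symmetric adj;
  adj_irr : irreflexive adj;
  adj_connected : forall u v, connect adj u v;
  vertex_gt0 : (0 < #|vertex|)%N }.

(* [prefs G] is the product over i of the permutations of the neighbors of i. *)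
Definition prefs (G : cgraph) : finType :=
  {dffun forall i : G, {perm {j : G | adj i j}}}.

Record distr (R : realType) (T : finType) := Distr {
  weight :> T -> R;
  weight_ge0 : forall x, 0 <= weight x;
  weight_sum1 : \sum_(x : T) weight x = 1 }.

Section Words.
Context {G : cgraph}.

Definition W : {pred seq G} := [pred w |
  [forall i, forall j, adj i j ==> (count_mem i w * count_mem j w == 0)%N]].

Definition W2 : {pred seq G} := [pred w | (w \in W) && ~~ odd (size w)].

Definition W2le (r : nat) : {pred seq G} :=
  [pred w | (w \in W2) && (size w <= 2 * r)%N].

End Words.

Definition delete_at (T : Type) (p : nat) (s : seq T) : seq T :=
  take p s ++ drop p.+1 s.

(* The position of the match is the primitive datum of a policy, as the
   resulting word does not determine it.  The values of [match_pos] for w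
   outside W, or when no letter of w is adjacent to v, are irrelevant. *)
Record policy (R : realType) (G : cgraph) := Policy {
  pref_law : distr R (prefs G);
  match_pos : seq G -> G -> prefs G -> nat;
  match_posP : forall (w : seq G) (v : G) (s : prefs G),
    w \in W -> has (adj v) w ->
    (match_pos w v s < size w)%N && adj v (nth v w (match_pos w v s)) }.

Section Policy.
Context {R : realType} {G : cgraph}.
Variable phi : policy R G.

Definition odot (w : seq G) (v : G) (s : prefs G) : seq G :=
  if has (adj v) w then delete_at (match_pos phi w v s) w else rcons w v.

Definition buffer (z : seq G) (s : seq (prefs G)) : seq G :=
  foldl (fun w a => odot w a.1 a.2) [::] (zip z s).

Definition sub_additive : Prop :=
  forall (z' z'' : seq G) (s' s'' : seq (prefs G)),
    size s' = size z' -> size s'' = size z'' ->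
    (forall s, s \in s' ++ s'' -> 0 < pref_law phi s) ->
    (size (buffer (z' ++ z'') (s' ++ s''))
       <= size (buffer z' s') + size (buffer z'' s''))%N.

End Policy.

Definition letter (G : cgraph) : Type := (G * prefs G * G * prefs G)%type.
HB.instance Definition _ (G : cgraph) := Finite.on (letter G).

(* The library requires measurable spaces to be pointed; the point chosen here
   plays no role. *)
Definition letter_point (G : cgraph) : letter G :=
  let v := enum_val (Ordinal (vertex_gt0 G)) in
  let s : prefs G := [ffun i : G => 1%g] in
  (v, s, v, s).
HB.instance Definition _ (G : cgraph) :=
  isPointed.Build (letter G) (letter_point G).

Definition cylinders (G : cgraph) : set (set (int -> letter G)) :=
  [set C | exists (n : int) (B : set (letter G)), C = [set om | B (om n)]].

Definition Omega (G : cgraph) := g_sigma_algebraType (@cylinders G).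
HB.instance Definition _ (G : cgraph) := Measurable.on (Omega G).

(* [shift n] is the n-th iterate of the shift, for n in Z; the arrivals at
   time n are the four components of [om n]. *)
Definition shift {G : cgraph} (n : int) (om : Omega G) : Omega G :=
  fun t => om (t + n).

Section Input.
Context {R : realType} {G : cgraph}.
Variables (phi : policy R G) (mu : distr R G).

Definition letter_weight (a : letter G) : R :=
  let: (v0, s0, v1, s1) := a in
  mu v0 * pref_law phi s0 * mu v1 * pref_law phi s1.

(* Characterizes P as (mu (x) nu (x) mu (x) nu)^{(x) Z}: the alphabet being
   finite, the events below together with the empty set form a pi-system that
   generates the product sigma-algebra. *)
Definition product_law (P : probability (Omega G) R) : Prop :=
  forall (ts : seq int) (a : int -> letter G), uniq ts ->
    P [set om | forall t, t \in ts -> om t = a t] =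
      (\prod_(t <- ts) letter_weight (a t))%:E.

End Input.

Section RandomWords.
Context {G : cgraph}.

Definition random_word (Y : Omega G -> seq G) : Prop :=
  forall A : set (seq G), measurable (Y @^-1` A).

Definition Y2 (r : nat) : set (Omega G -> seq G) :=
  [set Y | random_word Y /\ forall om, Y om \in W2le r].

Definition Y2oo : set (Omega G -> seq G) :=
  \bigcup_(r in [set r | (1 <= r)%N]) Y2 r.

End RandomWords.

Section Dynamics.
Context {R : realType} {G : cgraph}.
Variable phi : policy R G.

Definition odot2 (w : seq G) (a : letter G) : seq G :=
  let: (v0, s0, v1, s1) := a in odot phi (odot phi w v0 s0) v1 s1.

Fixpoint Useq (Y : Omega G -> seq G) (n : nat) (om : Omega G) : seq G :=
  if n is k.+1 then odot2 (Useq Y k om) (om k%:Z) else Y om.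

(* The infimum of the empty set is +oo. *)
Definition tau1 (Y : Omega G -> seq G) (om : Omega G) : \bar R :=
  ereal_inf [set (n%:R)%:E | n in [set n : nat |
    (0 < n)%N /\ Useq Y n om = [::]]].

Definition stationary_solution (P : probability (Omega G) R)
    (U : Omega G -> seq G) : Prop :=
  [/\ random_word U,
      forall om, U om \in W2
    & {ae P, forall om, U (shift 1 om) = odot2 (U om) (om 0)}].

End Dynamics.

Definition construction_points {G : cgraph} (U : Omega G -> seq G)
  (om : Omega G) : set int := [set n | U (shift n om) = [::]].

Definition enumerates (c : int -> int) (A : set int) : Prop :=
  {homo c : i j / i < j} /\ range c = A.

(* [inl p] is the item initially stored at position p; [inr (t, false)] and
   [inr (t, true)] are the first and the second item arriving at time t. *)
Definition item : Type := (nat + int * bool)%type.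

(* Edges are recorded with both orientations. *)
Record matching := Matching {
  nodes : set item;
  edges : set (item * item) }.

Definition perfect (M : matching) : Prop :=
  forall i, nodes M i -> exists! j, edges M (i, j).

Definition matching_union (I : Type) (F : I -> matching) : matching :=
  Matching (\bigcup_i nodes (F i)) (\bigcup_i edges (F i)).

Definition arrivals : set item := range inr.

Definition arrivals_from (m : int) : set item :=
  [set i | if i is inr (t, _) then m <= t else False].

Definition restrict (m : int) (M : matching) : matching :=
  Matching (nodes M `&` arrivals_from m)
           (edges M `&` (arrivals_from m `*` arrivals_from m)).

(* Convergence of F m to M as m tends to -oo. *)
Definition past_limit (F : int -> matching) (M : matching) : Prop :=
  forall m0 : int,
    \forall k \near \oo, restrict m0 (F (- k%:Z)) = restrict m0 M.

Section Matchings.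
Context {R : realType} {G : cgraph}.
Variable phi : policy R G.

(* The content of the buffer as a list of (class, item), and the edges created
   so far. *)
Definition state : Type := (seq (G * item) * seq (item * item))%type.

Definition arrive (st : state) (x : item) (v : G) (s : prefs G) : state :=
  let: (q, E) := st in
  let w := unzip1 q in
  if has (adj v) w then
    let p := match_pos phi w v s in
    let y := (nth (v, x) q p).2 in
    (delete_at p q, [:: (x, y), (y, x) & E])
  else (rcons q (v, x), E).

Definition arrive2 (st : state) (t : int) (a : letter G) : state :=
  let: (v0, s0, v1, s1) := a in
  arrive (arrive st (inr (t, false)) v0 s0) (inr (t, true)) v1 s1.

Fixpoint run (w : seq G) (m : int) (k : nat) (om : Omega G) : state :=
  if k is j.+1 then arrive2 (run w m j om) (m + j%:Z) (om (m + j%:Z))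
  else (zip w [seq inl p | p <- iota 0 (size w)], [::]).

(* Meaningful for m <= n. *)
Definition matching_upto (Y : Omega G -> seq G) (m n : int) (om : Omega G)
    : matching :=
  let w := Y (shift m om) in
  Matching
    [set i | match i with
             | inl p => (p < size w)%N
             | inr (t, _) => m <= t < n
             end]
    [set` (run w m `|n - m|%N om).2].

Definition matching_oo (Y : Omega G -> seq G) (m : int) (om : Omega G)
    : matching :=
  matching_union (fun k : nat => matching_upto Y m (m + k%:Z) om).

Definition biinfinite_matching (P : probability (Omega G) R)
    (M : Omega G -> matching) : Prop :=
  exists2 Y, Y2oo Y &
    {ae P, forall om,
      [/\ nodes (M om) = arrivals,
          edges (M om) `<=` arrivals `*` arrivals
        & past_limit (fun m => matching_oo Y m om) (M om)]}.

Definition stationary_matching (c : int -> int) (om : Omega G) : matching :=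
  matching_union
    (fun i : int => matching_upto (fun=> [::]) (c i) (c (i + 1)) om).

Lemma arrive_word (st : state) x v s :
  unzip1 (arrive st x v s).1 = odot phi (unzip1 st.1) v s.
Proof.
case: st => q E; rewrite /arrive /odot /=; case: ifP => _ /=.
  by rewrite /delete_at /unzip1 map_cat map_take map_drop.
by rewrite /unzip1 map_rcons.
Qed.

Lemma run_word (Y : Omega G -> seq G) n om :
  unzip1 (run (Y om) 0 n om).1 = Useq phi Y n om.
Proof.
elim: n => [|n IHn] /=.
  by rewrite unzip1_zip // size_map size_iota.
rewrite add0r /arrive2 /odot2; case: (om n) => -[[v0 s0] v1] s1.
by rewrite !arrive_word IHn.
Qed.

End Matchings.

(* Main.v *)
Require Import Defs.
From HB Require Import structures.
From mathcomp Require Import all_boot all_order all_fingroup all_algebra.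
From mathcomp Require Import all_classical all_reals all_analysis.
From mathcomp Require Import measurable_realfun zify.

Import Order.TTheory GRing.Theory Num.Theory.
Local Open Scope classical_set_scope.
Local Open Scope ring_scope.

Set Implicit Arguments.
Unset Strict Implicit.
Unset Printing Implicit Defensive.

Local Notation shift := Defs.shift.
Local Notation restrict := Defs.restrict.

(** The arrivals are i.i.d., and the buffer at even times is a Markov chain on
    [W2], driven by them.  Everything reduces to its synchronization in the
    past ([ae_synchronized]): almost surely there are times c, arbitrarily far
    in the past, at which all the trajectories started early enough from words
    of bounded size are empty simultaneously.

    Synchronization combines two facts.

    First, the sum over k of the probabilities that the time needed to empty
    the buffer exceeds k is the mean of that time.  By Borel-Cantelli, a
    trajectory started at -k, for k large, is empty at some time before 0.  From
    there it is a trajectory started later from the empty word, to which the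
    same applies, until the start lies in a bounded random window [-B, 0].  So
    all the trajectories started before -B occupy, at time 0, finitely many
    words, of size at most 2B ([ae_bounded_past]).

    Second, if any two vertices are joined by a walk of odd length, there is a
    word of arrivals, made of pairs of adjacent classes, that empties all the
    buffers of size at most 2B and maps the empty buffer to itself
    ([erase_short]): pairs of arrivals move the stored letters along the graph,
    and two letters joined by an odd walk can be brought next to each other.  If
    some vertices are joined by no odd walk, [G] is bipartite, and the imbalance
    between the two sides of the buffer is a random walk; it varies arbitrarily
    much over long series of identical arrivals, which contradicts
    [ae_bounded_past] ([stable_odd_walks]).

    The erasing word has positive probability and is independent of the past;
    if it arrives at a time when the sizes are bounded by 2B, synchronization
    occurs.  That this happens almost surely follows from stationarity: the
    event that synchronization has not occurred before time 0 has the same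
    probability as, hence is almost surely equal to, the smaller event that it
    has not occurred before a later time, whereas the erasing word separates
    them ([P_renovation]).

    Between two times at which the buffer is empty the dynamics only depends on
    the arrivals in between.  Hence the trajectories started from the empty word
    at -k have a limit U as k grows, the construction points of U are
    unbounded in the past by synchronization and in the future by finiteness of
    the hitting times, and the matchings started from any bounded word at -k
    coincide, from some construction point on, with the one started from the
    empty word at that point; their limit is perfect because each item lies
    between two construction points.  Any other stationary solution is, by
    Poincare recurrence ([ae_short_past]), of bounded size at infinitely many
    times in the past, so that synchronization applies to it as well. *)

(** * The law of the arrivals *)

Definition cylinder {G : cgraph} (ts : seq int) (a : int -> letter G) :
  set (Omega G) := [set om | forall t, t \in ts -> om t = a t].

Definition arr {G : cgraph} (s : int) (n : nat) (om : Omega G) :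
  seq (letter G) := [seq om (s + i%:Z) | i <- iota 0 n].

Section Measurability.
Context {G : cgraph}.
Implicit Types (om : Omega G) (A : set (Omega G)).

Lemma measurable_coord (t : int) (B : set (letter G)) :
  measurable [set om : Omega G | B (om t)].
Proof. by apply: sub_sigma_algebra; exists t, B. Qed.

Lemma measurable_cylinder ts a : measurable (@cylinder G ts a).
Proof.
elim: ts => [|t ts IH].
  by rewrite (_ : cylinder _ _ = setT) //; apply/seteqP; split.
rewrite (_ : cylinder _ _ = [set om | om t = a t] `&` cylinder ts a).
  by apply: measurableI => //; apply: (measurable_coord t [set x | x = a t]).
apply/seteqP; split=> om /=.
  move=> h; split; first by apply: h; rewrite mem_head.
  by move=> u us; apply: h; rewrite inE us orbT.
by case=> h1 h2 u; rewrite inE => /orP[/eqP ->//|]; exact: h2.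
Qed.

Lemma arrP (s : int) (n : nat) om om' :
  (forall t, s <= t < s + n%:Z -> om t = om' t) -> arr s n om = arr s n om'.
Proof.
move=> h; apply/eq_in_map => i; rewrite mem_iota => /andP[_ lin].
by apply: h; lia.
Qed.

Lemma arr_eq (s s' : int) n om : s = s' -> arr s n om = arr s' n om.
Proof. by move=> ->. Qed.

Lemma arr_cat (s : int) (m n : nat) om :
  arr s (m + n) om = arr s m om ++ arr (s + m%:Z) n om.
Proof.
rewrite /arr iotaD map_cat; congr (_ ++ _).
rewrite add0n -[in iota m n](addn0 m) iotaDl -map_comp; apply: eq_map => i /=.
by congr (om _); lia.
Qed.

Lemma arr_shift (s u : int) n om : arr s n (shift u om) = arr (s + u) n om.
Proof. by apply: eq_map => i; rewrite /shift; congr (om _); lia. Qed.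

Lemma shift_add (u v : int) om : shift u (shift v om) = shift (u + v) om.
Proof. by apply/funext => t; rewrite /shift addrA. Qed.

Lemma shift_zero om : shift 0 om = om.
Proof. by apply/funext => t; rewrite /shift addr0. Qed.

(** Words over a finite alphabet are countably many, so that an event that
    concerns finitely many arrivals is a countable union of cylinders. *)
Lemma measurable_arr (s : int) (n : nat) (Q : set (seq (letter G))) :
  measurable [set om | Q (arr s n om)].
Proof.
rewrite (_ : mkset _ =
  \bigcup_(z : seq (letter G)) [set om | Q z /\ arr s n om = z]).
  apply: countable_bigcupT_measurable; first exact: countableP.
  move=> z; have [Qz|nQz] := pselect (Q z); last first.
    by rewrite (_ : mkset _ = set0) //; apply/seteqP; split => // om [].
  have [/eqP sz|sz] := boolP (size z == n); last first.
    rewrite (_ : mkset _ = set0) //; apply/seteqP; split => // om [_ h].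
    by move: sz; rewrite -h size_map size_iota eqxx.
  rewrite (_ : mkset _ = cylinder [seq s + i%:Z | i <- iota 0 n]
     (fun t => nth (letter_point G) z `|t - s|%N)).
    exact: measurable_cylinder.
  apply/seteqP; split=> om /=.
    move=> [_ h] t /mapP[i]; rewrite mem_iota => /andP[_ lin] ->.
    rewrite (_ : `|(s + i%:Z - s)%R|%N = i); last by lia.
    by rewrite -h (nth_map 0%N) ?size_iota// nth_iota.
  move=> h; split=> //; apply: (@eq_from_nth _ (letter_point G)).
    by rewrite size_map size_iota.
  rewrite size_map size_iota => i lin.
  rewrite (nth_map 0%N) ?size_iota// nth_iota// add0n h; last first.
    by apply/mapP; exists i => //; rewrite mem_iota.
  by congr (nth _ _ _); lia.
apply/seteqP; split=> [om Qom|om [z _ /= [Qz h]]]; first by exists (arr s n om).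
by rewrite /= h.
Qed.

Lemma cylinder_setI : setI_closed
  [set A | A = set0 \/ exists ts a, A = @cylinder G ts a].
Proof.
move=> A B [->|[ts [a ->]]]; first by rewrite set0I; left.
case=> [->|[ts' [a' ->]]]; first by rewrite setI0; left.
have [[om [h h']]|n] := pselect (cylinder ts a `&` cylinder ts' a' !=set0).
  right; exists (ts ++ ts'), om; apply/seteqP; split=> om' /=.
    move=> [g g'] t; rewrite mem_cat => /orP[]ht; first by rewrite g// h.
    by rewrite g'// h'.
  move=> g; split=> t ht; first by rewrite g ?h// mem_cat ht.
  by rewrite g ?h'// mem_cat ht orbT.
by left; apply/seteqP; split=> // om hom; apply: n; exists om.
Qed.

Lemma measurable_cylindersE : @measurable _ (Omega G) =
  <<s [set A | A = set0 \/ exists ts a, A = @cylinder G ts a] >>.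
Proof.
apply/seteqP; split; last first.
  apply: smallest_sub; first exact: sigma_algebra_measurable.
  by move=> A [->//|[ts [a ->]]]; exact: measurable_cylinder.
apply: smallest_sub; first exact: smallest_sigma_algebra.
move=> A [n [B ->]].
pose T := g_sigma_algebraType
  [set A | A = set0 \/ exists ts a, A = @cylinder G ts a].
rewrite (_ : mkset _ = \bigcup_(x in B) cylinder [:: n] (fun=> x)).
  apply: (@fin_bigcup_measurable _ T) => //.
  move=> x _; apply: sub_sigma_algebra; right; by exists [:: n], (fun=> x).
apply/seteqP; split=> [om Bom|om [x Bx]] /=.
  by exists (om n) => // t; rewrite inE => /eqP ->.
by move=> /(_ n (mem_head _ _)) ->.
Qed.

(** Finite-dimensional cylinders form a pi-system containing the whole space. *)
Lemma Omega_measure_unique (R : realType)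
    (m1 m2 : {measure set (Omega G) -> \bar R}) :
  (m1 setT < +oo)%E ->
  (forall ts a, uniq ts -> m1 (cylinder ts a) = m2 (cylinder ts a)) ->
  forall A, measurable A -> m1 A = m2 A.
Proof.
move=> m1T m12 A mA.
apply: (measure_unique _ (fun=> setT) measurable_cylindersE cylinder_setI) => //.
- move=> _; right; exists [::], (fun=> letter_point G).
  by apply/seteqP; split.
- by rewrite bigcup_const.
- move=> B [->|[ts [a ->]]]; first by rewrite !measure0.
  rewrite (_ : cylinder ts a = cylinder (undup ts) a) ?m12 ?undup_uniq//.
  by apply/seteqP; split=> om /= h t ht; apply: h; move: ht; rewrite mem_undup.
Qed.

Lemma measurable_fun_Omega (f : Omega G -> Omega G) :
  (forall t (B : set (letter G)), measurable [set om | B (f om t)]) ->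
  measurable_fun setT f.
Proof.
move=> h; apply: (@measurability _ _ (Omega G) (Omega G) setT f (@cylinders G)) => //.
by move=> A [_ [n [B ->]] <-]; rewrite setTI; exact: h.
Qed.

Lemma measurable_shift n : measurable_fun setT (@shift G n).
Proof. by apply: measurable_fun_Omega => t B; exact: measurable_coord. Qed.

Lemma measurable_preshift n A : measurable A -> measurable (shift n @^-1` A).
Proof. by move=> mA; rewrite -[X in measurable X]setTI; apply: measurable_shift. Qed.

Definition set_coord (u : int) (e : letter G) om : Omega G :=
  fun t => if t == u then e else om t.

Lemma measurable_set_coord u e : measurable_fun setT (set_coord u e).
Proof.
apply: measurable_fun_Omega => t B; rewrite /set_coord.
case: (t == u); last exact: measurable_coord.
have [Be|nBe] := pselect (B e).
  by rewrite (_ : mkset _ = setT) //; apply/seteqP; split.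
by rewrite (_ : mkset _ = set0) //; apply/seteqP; split.
Qed.

End Measurability.

Section Law.
Context {R : realType} {G : cgraph}.
Variables (phi : policy R G) (mu : distr R G).
Variables (P : probability (Omega G) R) (P_law : product_law phi mu P).
Implicit Types (om : Omega G) (A : set (Omega G)).

Local Notation wt := (letter_weight phi mu).

Lemma letter_weight_ge0 a : 0 <= wt a.
Proof.
by case: a => -[[v0 s0] v1] s1; rewrite /letter_weight !mulr_ge0// weight_ge0.
Qed.

Lemma P_shift n A : measurable A -> P (shift n @^-1` A) = P A.
Proof.
move=> mA.
pose m1 : {measure set (Omega G) -> \bar R} :=
  measure_function_pushforward__canonical__measure_function_Measure P
    (measurable_shift n).
have -> : P (shift n @^-1` A) = m1 A by [].
apply: Omega_measure_unique => //.
  by rewrite /= /pushforward preimage_setT probability_setT ltry.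
move=> ts a uts; rewrite /= /pushforward P_law//.
rewrite (_ : _ @^-1` _ =
    cylinder [seq t + n | t <- ts] (fun t => a (t - n))).
  rewrite P_law; last by rewrite map_inj_uniq// => x y /addIr.
  by rewrite big_map; under eq_bigr do rewrite addrK.
apply/seteqP; split=> om /= h t.
  by move=> /mapP[u uts' ->]; rewrite addrK -h.
by move=> tts; rewrite /shift h ?addrK//; apply/mapP; exists t.
Qed.

(** The coordinate at u is independent of the other ones: forcing its value to e
    amounts to conditioning on that value. *)
Lemma P_set_coord u e A : measurable A ->
  P (A `&` [set om | om u = e]) = ((wt e)%:E * P (set_coord u e @^-1` A))%E.
Proof.
move=> mA; have mE : measurable [set om : Omega G | om u = e].
  exact: (measurable_coord u [set x | x = e]).
pose m1 : {measure set (Omega G) -> \bar R} := mrestr P mE.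
pose m2 : {measure set (Omega G) -> \bar R} :=
  mscale (NngNum (letter_weight_ge0 e))
  (measure_function_pushforward__canonical__measure_function_Measure P
    (measurable_set_coord u e)).
have -> : P (A `&` [set om | om u = e]) = m1 A by [].
rewrite -[RHS]/(m2 A); apply: Omega_measure_unique => //.
  by rewrite /= /mrestr (le_lt_trans (probability_le1 _ _)) ?ltry// setTI.
move=> ts a uts; rewrite /m1 /m2 /= /mrestr /mscale /= /pushforward.
have [uin|unin] := boolP (u \in ts); last first.
  rewrite (_ : cylinder ts a `&` _ =
      cylinder (u :: ts) (fun t => if t == u then e else a t)); last first.
    apply/seteqP; split=> om /=.
      move=> [h <-] t; rewrite inE; case: eqP => [->//|_ /=]; exact: h.
    move=> h; split; last by rewrite h ?mem_head ?eqxx.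
    move=> t tts; rewrite h ?inE ?tts ?orbT//.
    by case: eqP => // tu; rewrite -tu tts in unin.
  rewrite P_law /= ?unin// big_cons eqxx EFinM; congr (_ * _)%E.
  rewrite (_ : _ @^-1` _ = cylinder ts a).
    rewrite P_law//; congr (_%:E); apply: eq_big_seq => t tts.
    by case: eqP => // tu; rewrite -tu tts in unin.
  apply/seteqP; split=> om /= h t tts; move: (h t tts); rewrite /set_coord;
  by case: eqP => // tu; rewrite -tu tts in unin.
have [aue|aue] := eqVneq (a u) e; last first.
  rewrite (_ : _ `&` _ = set0); last first.
    apply/seteqP; split=> // om [/= /(_ u uin) h1 h2].
    by move: aue; rewrite -h1 h2 eqxx.
  rewrite (_ : _ @^-1` _ = set0) ?measure0 ?mule0//.
  apply/seteqP; split=> // om /(_ u uin) /eqP.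
  by rewrite /set_coord eqxx eq_sym (negbTE aue).
rewrite (_ : _ `&` _ = cylinder ts a); last first.
  by apply/seteqP; split=> [om []//|om h]; split => //=; rewrite -aue; exact: h.
rewrite P_law// (_ : _ @^-1` _ = cylinder (rem u ts) a).
  rewrite P_law ?rem_uniq// -EFinM -aue.
  by rewrite (perm_big _ (perm_to_rem uin)) big_cons.
apply/seteqP; split=> om h t /=.
  rewrite mem_rem_uniq// !inE => /andP[tu tts].
  by rewrite -(h t tts) /set_coord (negbTE tu).
rewrite /set_coord; case: eqP => [->//|/eqP tu] tts.
by apply: h; rewrite mem_rem_uniq// !inE tu.
Qed.

Definition past (m : int) A : Prop := forall om om',
  (forall t, t < m -> om t = om' t) -> A om -> A om'.

(** Letter after letter: the past and the first letters of the pattern do not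
    involve the coordinate of the next letter. *)
Lemma P_past_pattern A (z : seq (letter G)) : measurable A -> past 0 A ->
  P (A `&` [set om | arr 0 (size z) om = z]) = ((\prod_(e <- z) wt e)%:E * P A)%E.
Proof.
move=> mA pA; elim/last_ind: z => [|z e IH].
  by rewrite big_nil mul1e (_ : mkset _ = setT) ?setIT//; apply/seteqP; split.
pose B := A `&` [set om | arr 0 (size z) om = z].
have mB : measurable B.
  by apply: measurableI => //; apply: (measurable_arr 0 _ [set x | x = z]).
rewrite (_ : A `&` _ = B `&` [set om | om (size z)%:Z = e]); last first.
  apply/seteqP; split=> om /=; rewrite size_rcons -addn1 arr_cat cats1 add0r addr0.
    by move=> [Aom /rcons_inj[h1 h2]].
  by move=> [[Aom h1] h2]; split=> //; rewrite h1 h2.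
rewrite P_set_coord// (_ : _ @^-1` _ = B).
  by rewrite IH -cats1 big_cat big_seq1/= EFinM muleCA muleA.
have E om : arr 0 (size z) (set_coord (size z)%:Z e om) = arr 0 (size z) om.
  by apply: arrP => t ht; rewrite /set_coord; case: eqP => //; lia.
apply/seteqP; split=> om; rewrite /B /= E => -[Aom h]; split=> //;
  apply: pA Aom.
  by move=> t ht; rewrite /set_coord; case: eqP => //; lia.
by move=> t ht; rewrite /set_coord; case: eqP => //; lia.
Qed.

(** Both events have the same, finite, probability. *)
Lemma P_shift_sub n A : measurable A -> shift n @^-1` A `<=` A ->
  P (A `\` shift n @^-1` A) = 0%E.
Proof.
move=> mA sA; have mS := measurable_preshift n mA.
rewrite measureD ?setIidr//=; last first.
  by rewrite (le_lt_trans (probability_le1 _ _)) ?ltry.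
have hf : P A \is a fin_num by exact: fin_num_measure.
by rewrite -[X in (_ - X)%E]/(P (shift n @^-1` A)) P_shift// subee.
Qed.

(** The zero-one argument behind all renovation properties below: by
    stationarity, the event D almost surely still holds at time [size z],
    whatever the letters z that arrive in between; these being independent of
    D and K, a pattern z incompatible with all this forces D and K to be almost
    surely incompatible. *)
Lemma P_renovation (D K : set (Omega G)) (z : seq (letter G)) :
  measurable D -> measurable K -> past 0 D -> past 0 K ->
  {in z, forall e, 0 < wt e} ->
  shift (size z)%:Z @^-1` D `<=` D ->
  (forall om, D om -> K om -> arr 0 (size z) om = z ->
    ~ D (shift (size z)%:Z om)) ->
  P (D `&` K) = 0%E.
Proof.
move=> mD mK pD pK z0 sD h.
have mDK : measurable (D `&` K) by exact: measurableI.
have pDK : past 0 (D `&` K).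
  by move=> om om' e [Dom Kom]; split; [exact: pD e Dom|exact: pK e Kom].
have mZ : measurable [set om : Omega G | arr 0 (size z) om = z].
  exact: (measurable_arr 0 _ [set x | x = z]).
have /eqP : P ((D `&` K) `&` [set om | arr 0 (size z) om = z]) = 0%E.
  apply/eqP; rewrite eq_le measure_ge0 andbT -(P_shift_sub mD sD).
  apply: le_measure; rewrite ?inE; first exact: measurableI.
    by apply: measurableD => //; exact: measurable_preshift.
  by move=> om [[Dom Kom] e]; split=> //; exact: h.
rewrite P_past_pattern// mule_eq0 => /orP[|/eqP//].
have : 0 < \prod_(e <- z) wt e by rewrite big_seq; apply: prodr_gt0 => e /z0.
by rewrite eqe => /lt0r_neq0/negbTE ->.
Qed.

Lemma ae_shift n (Q : set (Omega G)) :
  {ae P, forall om, Q om} -> {ae P, forall om, Q (shift n om)}.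
Proof.
move=> [N [mN N0 QN]]; exists (shift n @^-1` N); split.
- exact: measurable_preshift.
- by rewrite P_shift.
- by move=> om /= nQ; exact: QN.
Qed.

Lemma ae_forall_countable (T : countType) (Q : T -> set (Omega G)) :
  (forall x, {ae P, forall om, Q x om}) ->
  {ae P, forall om, forall x, Q x om}.
Proof.
move=> h; have /ae_foralln : forall n,
    {ae P, forall om, if unpickle n is Some x then Q x om else True}.
  move=> n; case: (unpickle n) => [x|]; first exact: h.
  exact: aeW.
by apply: filterS => om g x; move: (g (pickle x)); rewrite pickleK.
Qed.

End Law.

(** * The buffer driven by a word of arrivals *)

Lemma perm_delete_at (T : eqType) (x0 : T) p (s : seq T) : (p < size s)%N ->
  perm_eq s (nth x0 s p :: delete_at p s).
Proof.
move=> ps; rewrite -[in X in perm_eq X](cat_take_drop p s) (drop_nth x0 ps).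
by rewrite -cat1s perm_catCA.
Qed.

Section Feed.
Context {R : realType} {G : cgraph}.
Variables (phi : policy R G).
Implicit Types (w x y : seq G) (a b c u v : G) (s : prefs G).
Implicit Types (z : seq (letter G)).

Lemma WP w : reflect {in w &, forall i j, ~~ adj i j} (w \in W).
Proof.
apply: (iffP forallP) => [h i j iw jw|h i].
  apply/negP => ij; move: (forallP (h i) j); rewrite ij muln_eq0.
  by case/orP => /eqP/count_memPn; rewrite ?iw ?jw.
apply/forallP => j; apply/implyP => ij; rewrite muln_eq0.
case: (boolP (i \in w)) => [iw|/count_memPn -> //].
case: (boolP (j \in w)) => [jw|/count_memPn -> //]; last by rewrite orbT.
by move: (h i j iw jw); rewrite ij.
Qed.

Lemma W_sub w w' : {subset w' <= w} -> w \in W -> w' \in W.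
Proof. by move=> sub /WP h; apply/WP => i j /sub iw /sub jw; exact: h. Qed.

Lemma odot_match w v s : w \in W -> has (adj v) w ->
  exists2 c, adj v c & perm_eq w (c :: odot phi w v s).
Proof.
move=> wW hw; have /andP[pw av] := match_posP phi s wW hw.
rewrite /odot hw; exists (nth v w (match_pos phi w v s)) => //.
exact: perm_delete_at.
Qed.

Lemma odot_store w v s : ~~ has (adj v) w -> odot phi w v s = rcons w v.
Proof. by rewrite /odot => /negbTE ->. Qed.

Lemma W_odot w v s : w \in W -> odot phi w v s \in W.
Proof.
move=> wW; case: (boolP (has (adj v) w)) => hw.
  have [c _ pc] := odot_match s wW hw.
  by apply: W_sub wW => i iw; rewrite (perm_mem pc) inE iw orbT.
rewrite odot_store//; apply/WP => i j; rewrite !mem_rcons !inE.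
have nv k : k \in w -> ~~ adj v k.
  by move=> kw; apply: contra hw => vk; apply/hasP; exists k.
case/orP=> [/eqP ->|iw]; case/orP=> [/eqP ->|jw].
- by rewrite adj_irr.
- exact: nv.
- by rewrite adj_sym nv.
- by move/WP: wW; apply.
Qed.

Lemma odd_odot w v s : w \in W ->
  odd (size (odot phi w v s)) = ~~ odd (size w).
Proof.
move=> wW; case: (boolP (has (adj v) w)) => hw.
  by have [c _ /perm_size ->] := odot_match s wW hw; rewrite /= negbK.
by rewrite odot_store// size_rcons.
Qed.

Lemma W2E w : (w \in W2) = (w \in W) && ~~ odd (size w).
Proof. by []. Qed.

Lemma W2_odot2 w (e : letter G) : w \in W2 -> odot2 phi w e \in W2.
Proof.
case: e => -[[v0 s0] v1] s1; rewrite !W2E /odot2 => /andP[wW ow].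
by rewrite !W_odot// !odd_odot ?W_odot// negbK.
Qed.

Definition feed w z := foldl (odot2 phi) w z.

Lemma feed_cat w z z' : feed w (z ++ z') = feed (feed w z) z'.
Proof. exact: foldl_cat. Qed.

Lemma W2_feed w z : w \in W2 -> feed w z \in W2.
Proof. by elim: z w => //= e z IH w /(W2_odot2 e) /IH. Qed.

Lemma nil_W2 : [::] \in @W2 G.
Proof. by rewrite W2E andbT; apply/WP => i j; rewrite in_nil. Qed.

Lemma size_odot2 w (e : letter G) :
  w \in W2 -> (size (odot2 phi w e) <= size w + 2)%N.
Proof.
have h w' v s : w' \in W -> (size (odot phi w' v s) <= size w' + 1)%N.
  move=> wW; case: (boolP (has (adj v) w')) => hw.
    have [c _ /perm_size ->] := odot_match s wW hw; rewrite /=; lia.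
  by rewrite odot_store// size_rcons; lia.
case: e => -[[v0 s0] v1] s1; rewrite W2E => /andP[wW ow] /=.
by have := h w v0 s0 wW; have := h _ v1 s1 (W_odot v0 s0 wW); lia.
Qed.

Lemma size_feed w z : w \in W2 -> (size (feed w z) <= size w + 2 * size z)%N.
Proof.
elim: z w => [|e z IH] w wW /=; first by lia.
by have := IH _ (W2_odot2 e wW); have := size_odot2 e wW; lia.
Qed.

Lemma Useq_feed (Y : Omega G -> seq G) n om :
  Useq phi Y n om = feed (Y om) (arr 0 n om).
Proof.
by elim: n => // n IH; rewrite -addn1 arr_cat feed_cat -IH addn1 /= add0r addr0.
Qed.

End Feed.

(** * Walks and their parity *)

Section Walks.
Context {G : cgraph}.
Implicit Types (a b c d : G).

Fixpoint walk (n : nat) a b : Prop :=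
  if n is m.+1 then exists2 c, adj a c & walk m c b else a = b.

Lemma walk_cat m n a b c : walk m a b -> walk n b c -> walk (m + n) a c.
Proof.
elim: m a => [a <-//|m IH a [d ad db]] bc.
by exists d => //; exact: IH.
Qed.

Lemma walk_head n a b : walk n.+1 a b -> exists2 c, adj a c & walk n c b.
Proof. by []. Qed.

Lemma walk1 a b : adj a b -> walk 1 a b.
Proof. by exists b. Qed.

Lemma walk_rcons n a b c : walk n a b -> adj b c -> walk n.+1 a c.
Proof. by move=> ab bc; rewrite -addn1; apply: walk_cat ab _; exact: walk1. Qed.

Lemma walk_sym n a b : walk n a b -> walk n b a.
Proof.
elim: n a => [a ->//|n IH a [d ad /IH dB]].
by apply: walk_rcons dB _; rewrite adj_sym.
Qed.

Lemma walk_connected a b : exists n, walk n a b.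
Proof.
have /connectP[p pp ->] := adj_connected a b; exists (size p).
by elim: p a pp => //= c p IH a /andP[ac cp]; exists c => //; exact: IH.
Qed.

Definition odd_walks := forall a b, exists k, walk k.*2.+1 a b.

Definition even_from a0 a : bool := `[< exists k, walk k.*2 a0 a >].

(** A pair of vertices joined by no odd walk yields the 2-colouring of [G] by
    the parity of the walks from the first of them. *)
Lemma even_from_adj a0 b0 : (forall k, ~ walk k.*2.+1 a0 b0) ->
  forall a b, adj a b -> even_from a0 b = ~~ even_from a0 a.
Proof.
move=> nob a b ab.
have both c k l : walk k.*2 a0 c -> walk l.*2.+1 a0 c -> False.
  move=> hk hl; have := walk_cat hl (walk_sym hk).
  rewrite addSn -doubleD => h; have [n hn] := walk_connected a0 b0.
  case: (boolP (odd n)) => on.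
    by apply: (nob n./2); rewrite -(odd_double_half n) on add1n in hn.
  apply: (nob (l + k + n./2)%N).
  by rewrite doubleD -addSn even_halfK//; exact: walk_cat hn.
apply/idP/idP.
  move=> /asboolP[k hk]; apply/negP => /asboolP[l hl].
  exact: (both b k l hk (walk_rcons hl ab)).
move=> /asboolP na; apply/asboolP; have [n hn] := walk_connected a0 a.
case: (boolP (odd n)) => on; last first.
  by exfalso; apply: na; exists n./2; rewrite even_halfK.
by exists n.+1./2; rewrite even_halfK/= ?on//; exact: walk_rcons hn ab.
Qed.

End Walks.

(** * The imbalance of a two-coloured graph *)

Section Imbalance.
Context {R : realType} {G : cgraph}.
Variables (phi : policy R G) (col : G -> bool).
Hypothesis col_adj : forall a b, adj a b -> col b = ~~ col a.
Implicit Types (w : seq G).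

Definition side_sign a : int := if col a then 1 else -1.
Definition imbalance w : int := \sum_(a <- w) side_sign a.

Lemma imbalance_odot w v s : w \in W ->
  imbalance (odot phi w v s) = imbalance w + side_sign v.
Proof.
move=> wW; case: (boolP (has (adj v) w)) => hw; last first.
  by rewrite odot_store// /imbalance -cats1 big_cat big_seq1.
have [c vc pc] := odot_match phi s wW hw.
have -> : side_sign v = - side_sign c.
  by rewrite /side_sign (col_adj vc); case: (col v); rewrite ?opprK.
by rewrite /imbalance (perm_big _ pc)/= big_cons addrAC subrr add0r.
Qed.

Lemma imbalance_nseq w v s n : w \in W2 ->
  imbalance (feed phi w (nseq n (v, s, v, s))) =
  imbalance w + side_sign v * (2 * n)%N%:Z.
Proof.
elim: n w => [|n IH] w wW2; first by rewrite mulr0 addr0.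
rewrite [feed _ _ _]/= IH; last exact: (W2_odot2 phi (v, s, v, s)).
move: wW2; rewrite W2E => /andP[wW _].
by rewrite !imbalance_odot ?W_odot//; lia.
Qed.

Lemma imbalance_feed w z : w \in W2 ->
  imbalance (feed phi w z) =
  imbalance w + imbalance (feed phi [::] z).
Proof.
move=> wW2; elim/last_ind: z => [|z e IH].
  by rewrite /imbalance big_nil addr0.
rewrite -cats1 !feed_cat /=.
have hs w' : w' \in W2 -> imbalance (odot2 phi w' e) =
    imbalance w' + (side_sign e.1.1.1 + side_sign e.1.2).
  case: e => -[[v0 s0] v1] s1; rewrite W2E => /andP[wW _] /=.
  by rewrite !imbalance_odot ?W_odot// addrA.
by rewrite !hs ?IH ?addrA//; apply: W2_feed => //; exact: nil_W2.
Qed.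

Lemma imbalance_size w : `|imbalance w| <= (size w)%:Z.
Proof.
elim: w => [|a w IH]; first by rewrite /imbalance big_nil.
by rewrite /imbalance big_cons -/(imbalance w) /side_sign /=; case: col; lia.
Qed.

End Imbalance.

(** * Erasing words *)

Section Erasing.
Context {R : realType} {G : cgraph}.
Variables (phi : policy R G) (s0 : prefs G).
Hypothesis oddG : @odd_walks G.
Implicit Types (w x y : seq G) (a b c u v : G).

(** Pairs of arrivals that are matched with each other if the buffer is empty.
    The list of preferences [s0] is to be one of positive probability. *)
Definition adj_letter (e : letter G) : bool :=
  [&& adj e.1.1.1 e.1.2, e.1.1.2 == s0 & e.2 == s0].

Lemma feed_nil_adj z : all adj_letter z -> feed phi [::] z = [::].
Proof.
elim: z => //= -[[[v sv] u] su] z IH /andP[/and3P[/= vu _ _] /IH].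
rewrite /= /odot /= adj_sym vu /=.
have := @match_posP R G phi [:: v] u su; rewrite /= adj_sym vu.
have W1 : [:: v] \in W.
  by apply/WP => i j; rewrite !inE => /eqP -> /eqP ->; rewrite adj_irr.
by move=> /(_ W1 isT); case: match_pos.
Qed.

(** One pair of arrivals moves a stored letter two steps along a walk: the
    first arrival [c] is matched, and the second one, [d], takes the vacant
    place unless it is matched as well. *)
Lemma move_letter x b c d : x \in W -> has (adj c) x ->
  b \in odot phi x c s0 ->
  let x' := odot2 phi x (c, s0, d, s0) in
  (size x' < size x)%N \/
  [/\ x' \in W, size x' = size x & exists r, perm_eq x' [:: d, b & r]].
Proof.
move=> xW hc bx' /=; have [c' cc' pc] := odot_match phi s0 xW hc.
have x'W := W_odot phi c s0 xW.
case: (boolP (has (adj d) (odot phi x c s0))) => hd.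
  left; have [e _ pe] := odot_match phi s0 x'W hd.
  by rewrite (perm_size pc) /= (perm_size pe) /= ltnS leqnSn.
right; split; first exact: W_odot.
  by rewrite odot_store// size_rcons (perm_size pc).
exists (rem b (odot phi x c s0)); rewrite odot_store//.
by rewrite perm_rcons perm_cons perm_to_rem.
Qed.

(** Induction on the length of an odd walk joining two stored letters: length
    1 is excluded as stored letters are not adjacent.  A walk
    a, c, d, ..., f, e, b of length at least 3 is shortened at one of its ends,
    by feeding (c, d) or (e, f); this only fails when [c] would be matched with
    [b] and [e] with [a], and then d, ..., e, a is an odd walk that is shorter
    and whose ends are both stored after (c, d). *)
Lemma erase_two m x a b r : ~~ odd m -> x \in W -> perm_eq x [:: a, b & r] ->
  walk m.+1 a b ->
  exists2 z, all adj_letter z & (size (feed phi x z) < size x)%N.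
Proof.
have [n] := ubnP m; elim: n m x a b r => // n IH m x a b r mn om xW px.
have ax : a \in x by rewrite (perm_mem px) mem_head.
have bx : b \in x by rewrite (perm_mem px) !inE eqxx orbT.
(* The induction hypothesis after the pair (c, d), if b' outlives it. *)
have step m' b' c d : (m' < n)%N -> ~~ odd m' ->
    has (adj c) x -> adj c d -> walk m'.+1 d b' -> b' \in odot phi x c s0 ->
  exists2 z, all adj_letter z & (size (feed phi x z) < size x)%N.
  move=> m'n om' hc cd wd b'x'.
  have al : adj_letter (c, s0, d, s0) by rewrite /adj_letter /= cd !eqxx.
  have [lt|[x'W sx' [r' px']]] := move_letter d xW hc b'x'.
    by exists [:: (c, s0, d, s0)]; rewrite //= al.
  have [z az hz] := IH m' _ _ _ _ m'n om' x'W px' wd.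
  by exists ((c, s0, d, s0) :: z); rewrite /= ?al// -sx'.
have matched c b' : b' \in x -> has (adj c) x -> b' \notin odot phi x c s0 ->
    adj c b' /\ perm_eq x (b' :: odot phi x c s0).
  move=> b'x hc; have [c' cc' pc] := odot_match phi s0 xW hc.
  by move: b'x; rewrite (perm_mem pc) inE => /orP[/eqP -> //|->].
move=> /walk_head[c ac wcb]; case: m om mn wcb => [_ _ cb|m om mn wcb].
  by move/WP: xW => /(_ _ _ ax bx); rewrite -(cb : c = b) ac.
have [e be wec] := walk_head (walk_sym wcb).
case: m om mn wcb wec => // m om mn wcb wec.
have {}om : ~~ odd m by move: om; rewrite /= negbK.
have mn' : (m < n)%N by rewrite ltnS in mn; exact: ltnW mn.
have [d cd wde] := walk_head (walk_sym wec).
have [f ef wfc] := walk_head wec.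
have hc : has (adj c) x by apply/hasP; exists a => //; rewrite adj_sym.
have he : has (adj e) x by apply/hasP; exists b => //; rewrite adj_sym.
have [bs|bns] := boolP (b \in odot phi x c s0).
  by apply: (step m b c d) => //; apply: walk_rcons wde _; rewrite adj_sym.
have [as_|ans] := boolP (a \in odot phi x e s0).
  by apply: (step m a e f) => //; apply: walk_rcons wfc _; rewrite adj_sym.
have [_ pb] := matched c b bx hc bns; have [ea _] := matched e a ax he ans.
apply: (step m a c d) => //; first exact: walk_rcons wde ea.
move: pb; rewrite (perm_sym x) => /perm_trans/(_ px).
have -> : perm_eq (b :: odot phi x c s0) [:: a, b & r] =
          perm_eq (b :: odot phi x c s0) [:: b, a & r].
  by apply: permPr; exact: (permEl (perm_catCA [:: a] [:: b] r)).
by rewrite perm_cons => /perm_mem ->; rewrite mem_head.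
Qed.

Lemma erase_word x : x \in W2 ->
  exists2 z, all adj_letter z & feed phi x z = [::].
Proof.
have [n] := ubnP (size x); elim: n x => // n IH x xn xW2.
have := xW2; rewrite W2E => /andP[xW ox].
case: x xn xW2 xW ox => [|a [//|b r]] xn xW2 xW ox; first by exists [::].
have [k wk] := oddG a b.
have [z az lt] := @erase_two k.*2 _ a b r (negbT (odd_double k)) xW (perm_refl _) wk.
have [z' az' hz'] := IH _ (leq_trans lt xn) (W2_feed phi z xW2).
by exists (z ++ z'); rewrite ?all_cat ?az// feed_cat.
Qed.

(** The erasing words are concatenated: as each of them maps the empty word to
    itself, a buffer emptied by one of them stays empty under the next ones. *)
Lemma erase_words (ws : seq (seq G)) : {subset ws <= W2} ->
  exists2 z, all adj_letter z & {in ws, forall x, feed phi x z = [::]}.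
Proof.
elim: ws => [|x ws IH] sub; first by exists [::].
have [|z az hz] := IH; first by move=> y yws; apply: sub; rewrite inE yws orbT.
have xW2 : x \in W2 by apply: sub; rewrite mem_head.
have [z' az' hz'] := erase_word (W2_feed phi z xW2).
exists (z ++ z'); first by rewrite all_cat az.
move=> y; rewrite inE feed_cat => /orP[/eqP -> //|/hz ->].
exact: feed_nil_adj.
Qed.

Lemma erase_short B : exists2 z, all adj_letter z &
  forall x, x \in W2 -> (size x <= B)%N -> feed phi x z = [::].
Proof.
pose short := [seq bseqval t | t <- enum {: B.-bseq G}].
have [x|z az hz] := @erase_words [seq x <- short | x \in W2].
  by rewrite mem_filter => /andP[].
exists z => // x xW2 xB; apply: hz; rewrite mem_filter xW2 /=.
by apply/mapP; exists (Bseq xB) => //; rewrite mem_enum.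
Qed.

End Erasing.

(** * Synchronization in the past *)

Section Events.
Context {G : cgraph}.

Lemma measurable_exists (T : countType) (F : T -> set (Omega G)) :
  (forall x, measurable (F x)) -> measurable [set om | exists x, F x om].
Proof.
move=> mF; rewrite (_ : mkset _ = \bigcup_x F x).
  by apply: countable_bigcupT_measurable => //; exact: countableP.
by apply/seteqP; split=> om [x]; [exists x|move=> _; exists x].
Qed.

Lemma measurable_forall (T : countType) (F : T -> set (Omega G)) :
  (forall x, measurable (F x)) -> measurable [set om | forall x, F x om].
Proof.
move=> mF; rewrite (_ : mkset _ = ~` [set om | exists x, (~` F x) om]).
  apply: measurableC; apply: (@measurable_exists T (fun x => ~` F x)) => x.
  by apply: measurableC; exact: mF.
apply/seteqP; split=> [om h [x]|om h x]; first by apply; exact: h.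
by apply: contrapT => nF; apply: h; exists x.
Qed.

Lemma measurable_imply (Q : Prop) (F : set (Omega G)) :
  measurable F -> measurable [set om | Q -> F om].
Proof.
move=> mF; have [q|nq] := pselect Q.
  rewrite (_ : mkset _ = F); first exact: mF.
  by apply/seteqP; split=> om /=; [apply|move=> Fom _].
have -> : [set om | Q -> F om] = setT by apply/seteqP; split=> // om _ /nq.
exact: measurableT.
Qed.

End Events.

Section Coalescence.
Context {R : realType} {G : cgraph} (phi : policy R G) (mu : distr R G).
Hypothesis mu_full : forall v : G, 0 < mu v.
Context (P : probability (Omega G) R) (P_law : product_law phi mu P).
Hypothesis tau1_int : forall Y : Omega G -> seq G, Y2oo Y ->
  P.-integrable setT (tau1 phi Y).
Implicit Types (om : Omega G) (y : seq G).

Local Notation feed := (feed phi).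

Definition unhit y (n : nat) : set (Omega G) :=
  [set om | forall j, (0 < j <= n)%N -> feed y (arr 0 j om) <> [::]].

Lemma measurable_unhit y n : measurable (unhit y n).
Proof.
apply: measurable_forall => j; apply: measurable_imply.
exact: (measurable_arr 0 j [set z | feed y z <> [::]]).
Qed.

Lemma W2_Y2oo y : y \in W2 -> Y2oo (fun=> y : seq G).
Proof.
move=> yW2; exists (size y).+1; rewrite /= ?ltnS//; split=> [A|_].
  have [Ay|nAy] := pselect (A y).
    by rewrite (_ : _ @^-1` _ = setT)//; apply/seteqP; split.
  by rewrite (_ : _ @^-1` _ = set0)//; apply/seteqP; split.
by rewrite /W2le inE; apply/andP; split=> //; lia.
Qed.

(** The events decrease, and at most the first tau of them hold. *)
Lemma unhit_le_tau1 y om :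
  (\sum_(n <oo) (\1_(unhit y n) om)%:E <= tau1 phi (fun=> y) om)%E.
Proof.
apply: lime_le; first by apply: is_cvg_nneseries => n _ _; rewrite lee_fin.
apply: nearW => n; apply: le_ereal_inf_tmp => _ [k [k0 hk] <-].
rewrite sumEFin lee_fin.
have cnt : (\sum_(0 <= i < n) (i < k) <= k)%N.
  suff -> : (\sum_(0 <= i < n) (i < k) = minn n k)%N by exact: geq_minr.
  elim: n => [|n IH]; first by rewrite big_nil min0n.
  by rewrite big_nat_recr//= IH; lia.
apply: (@le_trans _ _ (\sum_(0 <= i < n) (i < k)%N)%N%:R); last by rewrite ler_nat.
rewrite natr_sum; apply: ler_sum => i _; rewrite indicE ler_nat.
have [ik|ki] := ltnP i k; first by case: (_ \in _).
rewrite (_ : om \in unhit y i = false)//; apply/negP; rewrite inE => h.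
by apply: (h k); rewrite ?k0// -(Useq_feed phi (fun=> y)).
Qed.

Lemma unhit_summable y : y \in W2 -> (\sum_(n <oo) P (unhit y n) < +oo)%E.
Proof.
move=> yW2; have /integrableP[mtau tauoo] := tau1_int (W2_Y2oo yW2).
apply: le_lt_trans tauoo.
have mI n : measurable_fun setT (fun om => (\1_(unhit y n) om)%:E : \bar R).
  by apply/measurable_EFinP; apply: measurable_indic; exact: measurable_unhit.
have -> : (\sum_(n <oo) P (unhit y n) =
    \int[P]_om \sum_(n <oo) (\1_(unhit y n) om)%:E)%E.
  rewrite integral_nneseries//.
    apply: eq_eseriesr => n _; rewrite integral_indic ?setIT//.
    exact: measurable_unhit.
apply: ge0_le_integral => //.
- by move=> om _; apply: nneseries_ge0 => n _ _; rewrite lee_fin.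
- apply: ge0_emeasurable_sum => [n om _ _|n _]; first by rewrite lee_fin.
  exact: mI.
- exact: measurableT_comp.
- move=> om _; apply: le_trans (unhit_le_tau1 y om) _; exact: lee_abs.
Qed.

Lemma ae_hit_future y : y \in W2 ->
  {ae P, forall om, exists2 j, (0 < j)%N & feed y (arr 0 j om) = [::]}.
Proof.
move=> yW2; have /integrable_ae := tau1_int (W2_Y2oo yW2).
move=> /(_ measurableT); apply: filterS => om /(_ I) fin.
apply: contrapT => no; move: fin; rewrite /tau1 (_ : [set _ | n in _] = set0).
  by rewrite ereal_inf0.
rewrite -subset0 => x [n [n0 hn] _]; apply: no; exists n => //.
by rewrite -(Useq_feed phi (fun=> y)).
Qed.

(** By Borel-Cantelli, the time needed to empty the buffer from [y] at time -k
    is less than k for k large: its mean is the sum over k of the probability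
    of the contrary. *)
Lemma ae_hit_past y : y \in W2 -> {ae P, forall om, exists K, forall k,
  (K <= k)%N -> exists2 j, (0 < j <= k)%N & feed y (arr (- k%:Z) j om) = [::]}.
Proof.
move=> yW2; pose F k := shift (- k%:Z) @^-1` unhit y k.
have mF k : measurable (F k) by apply: measurable_preshift; exact: measurable_unhit.
exists (lim_sup_set F); split.
- by apply: bigcapT_measurable => n; exact: bigcup_measurable.
- apply: lim_sup_set_cvg0 => //.
  have PF k : P (F k) = P (unhit y k).
    by apply: (P_shift P_law); exact: measurable_unhit.
  rewrite (eq_eseriesr (fun k _ => PF k)).
  exact: unhit_summable.
- move=> om /= no n _; apply: contrapT => nF; apply: no; exists n => k nk.
  apply: contrapT => nohit; apply: nF; exists k => //= j jk.
  by rewrite arr_shift add0r => hj; apply: nohit; exists j.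
Qed.

Definition bounded_past (r B : nat) : set (Omega G) :=
  [set om | forall k, (B <= k)%N -> forall y, y \in W2le r ->
    (size (feed y (arr (- k%:Z) k om)) <= 2 * B)%N].

Lemma measurable_bounded_past r B : measurable (bounded_past r B).
Proof.
apply: measurable_forall => k; apply: measurable_imply.
apply: measurable_forall => y; apply: measurable_imply.
exact: (measurable_arr _ k [set z | (size (feed y z) <= 2 * B)%N]).
Qed.

Lemma W2le_W2 r y : y \in W2le r -> y \in W2.
Proof. by move=> /andP[]. Qed.

Lemma nil_W2le r : [::] \in @W2le G r.
Proof. by rewrite inE; apply/andP; split=> //; exact: nil_W2. Qed.

(** A trajectory started before -B is empty at some later time; from there it
    is a trajectory started from the empty word, and the argument can be
    repeated until the start lies in [-B, 0], a window that is too short for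
    the buffer to exceed 2B. *)
Lemma ae_bounded_past r : {ae P, forall om, exists B, bounded_past r B om}.
Proof.
have : {ae P, forall om, forall y : seq G, exists K, y \in W2 -> forall k,
    (K <= k)%N ->
    exists2 j, (0 < j <= k)%N & feed y (arr (- k%:Z) j om) = [::]}.
  apply: ae_forall_countable => y.
  have [yW2|nyW2] := boolP (y \in W2); last by apply: aeW => om; exists 0%N.
  by have := ae_hit_past yW2; apply: filterS => om [K hK]; exists K.
apply: filterS => om /choice[K hK].
pose B := \max_(t : (2 * r).-bseq G) K (bseqval t).
have KB y : y \in W2le r -> (K y <= B)%N.
  move=> yW; have yr : (size y <= 2 * r)%N by case/andP: yW.
  exact: (leq_bigmax (Bseq yr)).
exists B => k; have [n] := ubnP k; elim: n k => // n IH k kn Bk y yW.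
have [j /andP[j0 jk] hj] := hK y (W2le_W2 yW) k (leq_trans (KB _ yW) Bk).
have -> : arr (- k%:Z) k om =
    arr (- k%:Z) j om ++ arr (- (k - j)%N%:Z) (k - j) om.
  have es : - k%:Z + j%:Z = - (k - j)%N%:Z by lia.
  by rewrite -[in X in arr _ X _ = _](subnKC jk) arr_cat es.
rewrite feed_cat hj; have [Bkj|kjB] := leqP B (k - j).
  by apply: IH => //; [lia|exact: nil_W2le].
have := size_feed phi (arr (- (k - j)%N%:Z) (k - j) om) (@nil_W2 G).
rewrite size_map size_iota /=; lia.
Qed.

Lemma pref_gt0 : exists s0, 0 < pref_law phi s0.
Proof.
apply: contrapT => no; have := weight_sum1 (pref_law phi).
rewrite big1; first by move/esym/eqP; rewrite oner_eq0.
move=> s _; apply/eqP; rewrite eq_le weight_ge0 andbT leNgt.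
by apply/negP => s0; apply: no; exists s.
Qed.

Lemma not_ae_False : ~ {ae P, forall om : Omega G, False}.
Proof.
move=> [N [mN N0 sN]]; have : P N = 1%E.
  rewrite -(@probability_setT _ _ _ P); congr (P _).
  by apply/seteqP; split=> // om _; apply: sN => /=.
by rewrite N0 => /eqP; rewrite eq_sym onee_eq0.
Qed.

(** Were [G] bipartite, the number of stored items on one side minus the
    number of those on the other side would be a random walk.  It is bounded
    when looked at from the far past, but arbitrarily long series of
    arrivals of the same class occur in the past, over which it varies
    arbitrarily much. *)
Lemma stable_odd_walks : @odd_walks G.
Proof.
move=> a b; apply: contrapT => no.
have nob k : ~ walk k.*2.+1 a b by move=> h; apply: no; exists k.
have cadj := even_from_adj nob; have [s0 s0_gt0] := pref_gt0.
have ca : even_from a a by apply/asboolP; exists 0%N.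
pose e : letter G := (a, s0, a, s0).
have e_gt0 : 0 < letter_weight phi mu e by rewrite /= !mulr_gt0.
pose D N : set (Omega G) :=
  [set om | forall i : nat, arr (- (i + N)%N%:Z) N om <> nseq N e].
have mD N : measurable (D N).
  apply: measurable_forall => i.
  exact: (measurable_arr _ N [set z | z <> nseq N e]).
have D0 N : P (D N) = 0%E.
  rewrite -(setIT (D N)).
  apply: (@P_renovation _ _ _ _ _ P_law _ _ (nseq N e)) => //.
  - move=> om om' h Dom i; rewrite -(@arrP _ _ _ om) => [|t ht]; first exact: Dom.
    by apply: h; lia.
  - by move=> x; rewrite mem_nseq => /andP[_ /eqP ->].
  - move=> om Dom i; have := Dom (i + N)%N.
    by rewrite arr_shift size_nseq (@arr_eq _ _ (- (i + N)%N%:Z))//; lia.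
  - move=> om _ _; rewrite size_nseq => hN /(_ 0%N); apply.
    by rewrite arr_shift -[RHS]hN; apply: arr_eq; lia.
apply: not_ae_False.
(* The imbalance varies by 2 (2B + 1) over a block of 2B + 1 letters e, whereas
   two values bounded by 2B in absolute value differ by at most 4B. *)
have : {ae P, forall om, forall B, ~ D (2 * B).+1 (shift (- B%:Z) om)}.
  apply: ae_foralln => B; apply: (@ae_shift _ _ _ _ _ P_law (- B%:Z) (~` D _)).
  exists (D (2 * B).+1); split => //.
  by move=> om /= /contrapT.
apply: filterS2 (ae_bounded_past 0) => om [B hB] /(_ B); apply => i.
rewrite arr_shift => hblock; set N := (2 * B).+1 in hblock.
(* The block ends at -k1 and starts at -k2. *)
pose k1 := (i + B)%N; pose k2 := (k1 + N)%N.
have e2 : arr (- k2%:Z) k2 om = nseq N e ++ arr (- k1%:Z) k1 om.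
  have -> : arr (- k2%:Z) k2 om = arr (- k2%:Z) (N + k1) om by rewrite addnC.
  rewrite arr_cat -hblock.
  have -> : - k2%:Z + N%:Z = - k1%:Z by rewrite /k2; lia.
  by congr (_ ++ _); apply: arr_eq; rewrite /k2 /k1; lia.
have b1 : (size (feed [::] (arr (- k1%:Z) k1 om)) <= 2 * B)%N.
  by apply: hB; [rewrite /k1; lia|exact: nil_W2le].
have b2 : (size (feed [::] (arr (- k2%:Z) k2 om)) <= 2 * B)%N.
  by apply: hB; [rewrite /k2 /k1; lia|exact: nil_W2le].
have := imbalance_size (even_from a) (feed [::] (arr (- k1%:Z) k1 om)).
have := imbalance_size (even_from a) (feed [::] (arr (- k2%:Z) k2 om)).
rewrite e2 feed_cat in b2 *.
rewrite (imbalance_feed phi cadj _ (W2_feed phi _ nil_W2)).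
rewrite (imbalance_nseq phi cadj _ _ _ nil_W2).
rewrite {1}/imbalance big_nil /side_sign ca mul1r; lia.
Qed.

Definition synchronized (r : nat) : set (Omega G) :=
  [set om | exists i K : nat, forall k, (K <= k)%N ->
    forall y, y \in W2le r -> feed y (arr (- (i + k)%N%:Z) k om) = [::]].

Lemma measurable_synchronized r : measurable (synchronized r).
Proof.
apply: measurable_exists => i; apply: measurable_exists => K.
apply: measurable_forall => k; apply: measurable_imply.
apply: measurable_forall => y; apply: measurable_imply.
exact: (measurable_arr _ k [set z | feed y z = [::]]).
Qed.

Lemma ae_synchronized r : {ae P, forall om, synchronized r om}.
Proof.
have [s0 s0_gt0] := pref_gt0.
have sync0 B : {ae P, forall om, bounded_past r B om -> synchronized r om}.
  have [z az hz] := erase_short phi s0 stable_odd_walks (2 * B).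
  exists (~` synchronized r `&` bounded_past r B); split.
  - apply: measurableI; first by apply: measurableC; exact: measurable_synchronized.
    exact: measurable_bounded_past.
  - apply: (@P_renovation _ _ _ _ _ P_law _ _ z).
    + by apply: measurableC; exact: measurable_synchronized.
    + exact: measurable_bounded_past.
    + move=> om om' h nS [i [K hK]]; apply: nS; exists i, K => k Kk y yW.
      by rewrite (@arrP _ _ _ om om') ?hK// => t ht; apply: h; lia.
    + move=> om om' h hB k Bk y yW.
      by rewrite -(@arrP _ _ _ om om') ?hB// => t ht; apply: h; lia.
    + move=> e /(allP az) /and3P[_ /eqP e1 /eqP e2].
      by case: e e1 e2 => -[[v0 u0] v1] u1 /= -> ->; rewrite !mulr_gt0.
    + move=> om nS [i [K hK]]; apply: nS; exists (i + size z)%N, K => k Kk y yW.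
      by rewrite -[RHS](hK k Kk y yW) arr_shift; congr (feed _ _); apply: arr_eq; lia.
    (* Seen from time [size z], trajectories started B earlier than 0 are
       bounded at time 0 and erased between 0 and [size z]. *)
    + move=> om _ hB hz0; apply; exists 0%N, (B + size z)%N => k Bk y yW.
      have kz : (k = (k - size z) + size z)%N by lia.
      rewrite arr_shift add0n [in X in arr _ X _]kz arr_cat feed_cat.
      rewrite [X in feed _ X](_ : _ = z); last first.
        by rewrite -[RHS]hz0; apply: arr_eq; lia.
      apply: hz; first by apply/W2_feed/W2le_W2/yW.
      rewrite (_ : - k%:Z + (size z)%:Z = - (k - size z)%N%:Z); last by lia.
      by apply: hB => //; lia.
  - by move=> om /= /not_implyP[? ?]; split.
have /ae_foralln := sync0.
by apply: filterS2 (ae_bounded_past r) => om [B hB] /(_ B); apply.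
Qed.

(** The start is written c - k, with k the number of steps, so that no sign
    condition on k - c is needed to run the dynamics up to c. *)
Definition coalescent om : Prop := forall (r : nat) (m : int),
  exists c : int, c <= m /\ exists K : nat, forall k, (K <= k)%N ->
    forall y, y \in W2le r -> feed y (arr (c - k%:Z) k om) = [::].

Definition recurrent om : Prop := forall (m : int) y, y \in W2 ->
  exists2 j, (0 < j)%N & feed y (arr m j om) = [::].

Lemma ae_coalescent : {ae P, forall om, coalescent om}.
Proof.
apply: ae_foralln => r; apply: ae_forall_countable => m.
have := ae_shift P_law m (ae_synchronized r).
apply: filterS => om [i [K hK]]; exists (m - i%:Z); split; first by lia.
exists K => k Kk y yW; rewrite -[RHS](hK k Kk y yW) arr_shift.
by congr (feed _ _); apply: arr_eq; lia.
Qed.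

Lemma ae_recurrent : {ae P, forall om, recurrent om}.
Proof.
apply: ae_forall_countable => m; apply: ae_forall_countable => y.
have [yW2|nyW2] := boolP (y \in W2); last exact: aeW.
have := ae_shift P_law m (ae_hit_future yW2).
apply: filterS => om [j j0 hj] _; exists j => //.
by rewrite -hj arr_shift add0r.
Qed.

End Coalescence.

(** * The stationary buffer content *)

Section StationaryWord.
Context {R : realType} {G : cgraph} (phi : policy R G).
Implicit Types (om : Omega G) (w y : seq G) (m n c : int).

Local Notation feed := (feed phi).

Definition limit_word om : seq G :=
  xget [::] [set w | exists K : nat, forall k, (K <= k)%N ->
    feed [::] (arr (- k%:Z) k om) = w].

Lemma limit_wordE om w (K : nat) :
  (forall k, (K <= k)%N -> feed [::] (arr (- k%:Z) k om) = w) ->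
  limit_word om = w.
Proof.
move=> hK; apply: xget_unique; first by exists K.
move=> w' [K' hK'].
by rewrite -(hK (maxn K K')) ?leq_maxl// hK' ?leq_maxr.
Qed.

Lemma limit_word_W2 om : limit_word om \in W2.
Proof.
rewrite /limit_word; case: xgetP => [w _ [K hK]|_]; last exact: nil_W2.
by rewrite -(hK K (leqnn _)); apply: W2_feed; exact: nil_W2.
Qed.

(** The limit word takes countably many values, each of them, apart from the
    default one, on an event described by finite families of arrivals. *)
Lemma limit_word_random : random_word limit_word.
Proof.
move=> A.
pose L w : set (Omega G) := [set om | exists K : nat, forall k, (K <= k)%N ->
  feed [::] (arr (- k%:Z) k om) = w].
have mL w : measurable (L w).
  apply: measurable_exists => K; apply: measurable_forall => k.
  apply: measurable_imply; exact: (measurable_arr _ k [set z | feed [::] z = w]).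
have mC (Q : Prop) : measurable [set _ : Omega G | Q].
  have [q|nq] := pselect Q.
    have -> : [set _ : Omega G | Q] = setT by apply/seteqP; split.
    exact: measurableT.
  have -> : [set _ : Omega G | Q] = set0 by apply/seteqP; split.
  exact: measurable0.
have -> : limit_word @^-1` A =
    [set om | exists w, ([set _ | A w] `&` L w) om] `|`
    ([set _ | A [::]] `&` ~` [set om | exists w, L w om]).
  apply/seteqP; split=> om /=.
    rewrite /limit_word; case: xgetP => [w _ Lw Aw|no A0].
      by left; exists w; split.
    by right; split=> // -[w]; exact: no.
  case=> [[w [Aw [K hK]]]|[A0 no]]; first by rewrite (limit_wordE hK).
  rewrite /limit_word; case: xgetP => // w _ Lw; exfalso.
  by apply: no; exists w.
apply: measurableU.
  by apply: measurable_exists => w; apply: measurableI.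
by apply: measurableI => //; apply: measurableC; exact: measurable_exists.
Qed.

(** For d = 0 this says that c is a construction point; for larger d, that from c
    on the limit word is computed from the arrivals alone. *)
Lemma limit_word_from om c (K d : nat) :
  (forall k, (K <= k)%N -> feed [::] (arr (c - k%:Z) k om) = [::]) ->
  limit_word (shift (c + d%:Z) om) = feed [::] (arr c d om).
Proof.
move=> hK; apply: (@limit_wordE _ _ (K + d)) => k Kk.
have kd : (k = (k - d) + d)%N by lia.
have -> : arr (- k%:Z) k (shift (c + d%:Z) om) =
    arr (c - (k - d)%N%:Z) (k - d) om ++ arr c d om.
  rewrite arr_shift [in X in arr _ X _ = _]kd arr_cat.
  congr (_ ++ _); apply: arr_eq; lia.
by rewrite feed_cat hK//; lia.
Qed.

Lemma limit_word_feed om n (d : nat) : coalescent phi om ->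
  limit_word (shift (n + d%:Z) om) = feed (limit_word (shift n om)) (arr n d om).
Proof.
move=> /(_ 0%N n)[c [cn [K hK]]].
have h k : (K <= k)%N -> feed [::] (arr (c - k%:Z) k om) = [::].
  by move=> Kk; apply: hK => //; exact: nil_W2le.
have nc : n = c + `|n - c|%N%:Z by lia.
rewrite nc -addrA -PoszD !(limit_word_from _ h) arr_cat feed_cat.
by rewrite -nc.
Qed.

Lemma construction_point_before om m : coalescent phi om ->
  exists2 c, c <= m & limit_word (shift c om) = [::].
Proof.
move=> /(_ 0%N m)[c [cm [K hK]]]; exists c => //.
rewrite -[c]addr0 (@limit_word_from _ _ K 0)// => k Kk.
by apply: hK => //; exact: nil_W2le.
Qed.

Lemma construction_point_after om m : coalescent phi om -> recurrent phi om ->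
  exists2 c, m < c & limit_word (shift c om) = [::].
Proof.
move=> co /(_ m _ (limit_word_W2 (shift m om)))[j j0 hj].
by exists (m + j%:Z); [lia|rewrite limit_word_feed].
Qed.

End StationaryWord.

Section Stationary.
Context {R : realType} {G : cgraph} (phi : policy R G) (mu : distr R G).
Context (P : probability (Omega G) R) (P_law : product_law phi mu P).
Hypothesis P_coalescent : {ae P, forall om, coalescent phi om}.
Implicit Types (om : Omega G).

Lemma limit_word_stationary : stationary_solution phi P (limit_word phi).
Proof.
split; [exact: limit_word_random|exact: limit_word_W2|].
apply: filterS P_coalescent => om co.
by rewrite -[1]add0r (limit_word_feed 0 1 co)/= shift_zero.
Qed.

(** Poincare recurrence: the event that the word is long at all times before -m
    increases with m and has constant probability, hence it almost surely does
    not depend on m. *)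
Lemma ae_short_past (Y : Omega G -> seq G) (B : nat) : random_word Y ->
  {ae P, forall om, (size (Y om) <= B)%N -> forall m : nat,
    exists2 k, (m <= k)%N & (size (Y (shift (- k%:Z) om)) <= B)%N}.
Proof.
move=> mY; pose S : set (Omega G) := Y @^-1` [set w | (size w <= B)%N].
pose E : set (Omega G) := [set om | forall k : nat, (~` S) (shift (- k%:Z) om)].
have mE : measurable E.
  apply: measurable_forall => k.
  by apply: (measurable_preshift (- k%:Z)); apply: measurableC; exact: mY.
have /ae_foralln : forall m : nat,
    {ae P, forall om, E (shift (- m%:Z) om) -> E om}.
  move=> m; have null : {ae P, forall om, E om -> E (shift m%:Z om)}.
    exists (E `\` shift m%:Z @^-1` E); split.
    - by apply: measurableD => //; exact: measurable_preshift.
    - apply: (P_shift_sub P_law) => // om Em k.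
      have := Em (k + m)%N; rewrite shift_add.
      by rewrite (_ : - (k + m)%N%:Z + m%:Z = - k%:Z)//; lia.
    - by move=> om /= /not_implyP.
  have := ae_shift P_law (- m%:Z) null.
  by apply: filterS => om; rewrite shift_add subrr shift_zero.
apply: filterS => om ret S0 m; apply: contrapT => no.
apply: (ret m _ 0%N); last by rewrite /= oppr0 shift_zero.
move=> k Sk; apply: no; exists (k + m)%N; first exact: leq_addl.
by rewrite shift_add (_ : _ + _ = - (k + m)%N%:Z) in Sk; [exact: Sk|lia].
Qed.

(** By recurrence, another solution starts infinitely often in the past from a
    word of bounded size; coalescence then forces it to agree with the limit
    word at time 0. *)
Lemma stationary_unique (U : Omega G -> seq G) : stationary_solution phi P U ->
  {ae P, forall om, U om = limit_word phi om}.
Proof.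
move=> [mU UW2 eqU].
have eq_n : {ae P, forall om, forall n : int,
    U (shift (1 + n) om) = odot2 phi (U (shift n om)) (om n)}.
  apply: ae_forall_countable => n; have := ae_shift P_law n eqU.
  by apply: filterS => om; rewrite shift_add [shift n om 0]/shift add0r.
have short : {ae P, forall om, forall r : nat, (size (U om) <= 2 * r)%N ->
    forall m : nat, exists2 k, (m <= k)%N &
      (size (U (shift (- k%:Z) om)) <= 2 * r)%N}.
  by apply: ae_foralln => r; exact: ae_short_past.
move: P_coalescent eq_n short; apply: filterS3 => om co eq_n short.
have step n d : U (shift (n + d%:Z) om) = feed phi (U (shift n om)) (arr n d om).
  elim: d => [|d IH]; first by rewrite addr0.
  rewrite -addn1 arr_cat feed_cat -IH /= addr0 -eq_n.
  by rewrite (_ : n + (d + 1)%N%:Z = 1 + (n + d%:Z))//; lia.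
have [c [c0 [K hK]]] := co (size (U om)) 0.
have szU : (size (U om) <= 2 * size (U om))%N by lia.
have [k kK short_k] := short _ szU (K + `|c|%N)%N.
have from_c : U (shift c om) = [::].
  have -> : c = - k%:Z + (k - `|c|)%N%:Z by lia.
  rewrite step (@arr_eq _ _ (c - (k - `|c|)%N%:Z)); last by lia.
  by apply: hK; [lia|rewrite inE; apply/andP; split=> //; exact: UW2].
have cE : 0 = c + `|c|%N%:Z by lia.
rewrite -[in LHS](shift_zero om) -[in RHS](shift_zero om) cE step from_c.
rewrite (@limit_word_from _ _ _ _ _ K)// => j Kj.
by apply: hK => //; exact: nil_W2le.
Qed.

End Stationary.

(** * Runs of the matching procedure *)

Section Runs.
Context {R : realType} {G : cgraph} (phi : policy R G).
Implicit Types (om : Omega G) (w : seq G) (m c t : int) (x y : item).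
Implicit Types (E : seq (item * item)) (q : seq (G * item)).

Local Notation feed := (feed phi).
Local Notation run := (run phi).

Lemma arrive_frame q E x v s :
  arrive phi (q, E) x v s = ((arrive phi (q, [::]) x v s).1,
                             (arrive phi (q, [::]) x v s).2 ++ E).
Proof. by rewrite /arrive; case: ifP. Qed.

Lemma arrive2_frame q E t (a : letter G) :
  arrive2 phi (q, E) t a = ((arrive2 phi (q, [::]) t a).1,
                            (arrive2 phi (q, [::]) t a).2 ++ E).
Proof.
case: a => -[[v0 s0] v1] s1; rewrite /arrive2 (arrive_frame q E).
case: (arrive phi (q, [::]) _ _ _) => q' E'.
by rewrite (arrive_frame q' (E' ++ E)) (arrive_frame q' E') /= catA.
Qed.

Lemma run_word_feed w m j om : unzip1 (run w m j om).1 = feed w (arr m j om).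
Proof.
elim: j => [|j IH]; first by rewrite /= unzip1_zip// size_map size_iota.
rewrite -[in RHS](addn1 j) arr_cat feed_cat -IH /= addr0.
case: (om _) => -[[v0 s0] v1] s1; rewrite /arrive2 /odot2.
by rewrite !arrive_word.
Qed.

Lemma run_nil w m j om :
  feed w (arr m j om) = [::] -> (run w m j om).1 = [::].
Proof. by rewrite -run_word_feed; case: (run w m j om).1. Qed.

(** From an empty buffer, the edges already created are only carried along. *)
Lemma run_split w m j i om : (run w m j om).1 = [::] ->
  run w m (j + i) om = ((run [::] (m + j%:Z) i om).1,
                        (run [::] (m + j%:Z) i om).2 ++ (run w m j om).2).
Proof.
move=> h; elim: i => [|i IH]; first by rewrite addn0 /= -h; case: (run w m j om).
rewrite addnS /= IH arrive2_frame.
rewrite (_ : m + (j + i)%N%:Z = m + j%:Z + i%:Z); last by lia.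
case: (run [::] (m + j%:Z) i om) => q E /=.
by rewrite (arrive2_frame q E) /= catA.
Qed.

Lemma run_mono w m j i om : (j <= i)%N ->
  {subset (run w m j om).2 <= (run w m i om).2}.
Proof.
move=> /subnKC <-; elim: (i - j)%N => [|d IH] e ej; first by rewrite addn0.
rewrite addnS /=; move: (IH e ej); case: (run w m (j + d) om) => q E /=.
by rewrite arrive2_frame mem_cat => ->; rewrite orbT.
Qed.

(** The items met so far, each once: the stored ones and the first endpoints of
    the edges, every edge being recorded with both orientations. *)
Definition footprint (st : @state G) : seq item := unzip2 st.1 ++ unzip1 st.2.

Lemma perm_footprint (st : @state G) x v s : unzip1 st.1 \in W ->
  perm_eq (footprint (arrive phi st x v s)) (x :: footprint st).
Proof.
case: st => q E /= qW; rewrite /arrive /footprint; case: ifP => hq /=; last first.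
  by apply/seq.permP => a; rewrite /unzip2 map_rcons -cats1 /= !count_cat /=; lia.
have /andP[] := match_posP phi s qW hq; rewrite size_map => pq _.
have := perm_map snd (perm_delete_at (v, x) pq) => /seq.permP pd.
apply/seq.permP => a; have := pd a; rewrite /unzip2 /= !count_cat /= => ->.
by rewrite -!addnA addnCA; congr (_ + _)%N; rewrite addnCA.
Qed.

Fixpoint arrived w m (j : nat) : seq item :=
  if j is i.+1 then [:: inr (m + i%:Z, true), inr (m + i%:Z, false) & arrived w m i]
  else [seq inl p | p <- iota 0 (size w)].

Lemma mem_arrived w m j x : (x \in arrived w m j) =
  match x with inl p => (p < size w)%N | inr (t, _) => m <= t < m + j%:Z end.
Proof.
elim: j => [|j IH] /=.
  case: x => [p|[t b]].
    by rewrite mem_map ?mem_iota// => ? ? [].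
  rewrite (_ : (_ \in _) = false); first by apply/esym/negbTE; lia.
  by apply/negbTE/mapP => -[].
rewrite !inE IH; case: x {IH} => [p|[t b]]; first by [].
have inrE (u u' : int * bool) : (inr u == inr u' :> item) = (u == u') by [].
by rewrite !inrE !xpair_eqE; case: b; rewrite ?andbT ?andbF ?orbF/=; lia.
Qed.

Lemma uniq_arrived w m j : uniq (arrived w m j).
Proof.
elim: j => [|j IH] /=; first by rewrite map_inj_uniq ?iota_uniq// => ? ? [].
rewrite IH andbT inE !mem_arrived; apply/andP; split; last by lia.
by rewrite negb_or; apply/andP; split; [apply/eqP => -[]|lia].
Qed.

Lemma perm_run w m j om : w \in W2 ->
  perm_eq (footprint (run w m j om)) (arrived w m j).
Proof.
move=> wW2; elim: j => [|j IH].
  by rewrite /footprint /= cats0 /unzip2 -/(unzip2 _) unzip2_zip// size_map size_iota.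
have : unzip1 (run w m j om).1 \in W.
  by rewrite run_word_feed; have /andP[] := W2_feed phi (arr m j om) wW2.
rewrite /=; case: (om _) => -[[v0 s0] v1] s1; rewrite /arrive2 => qW.
apply: perm_trans (perm_footprint _ _ _ _) _.
  by rewrite arrive_word; exact: W_odot.
by rewrite perm_cons; apply: perm_trans (perm_footprint _ _ _ qW) _; rewrite perm_cons.
Qed.

Lemma run_sym w m j om x y :
  (x, y) \in (run w m j om).2 -> (y, x) \in (run w m j om).2.
Proof.
pose sym E := forall x y, (x, y) \in E -> (y, x) \in E.
have symA (st : @state G) z v s : sym st.2 -> sym (arrive phi st z v s).2.
  case: st => q E symE; rewrite /arrive /=; case: ifP => // _ a b /=.
  rewrite !inE => /or3P[/eqP[-> ->]|/eqP[-> ->]|/symE ->].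
  - by rewrite eqxx orbT.
  - by rewrite eqxx.
  - by rewrite !orbT.
suff : sym (run w m j om).2 by apply.
elim: j => [|j IH] //=; case: (om _) => -[[v0 s0] v1] s1.
exact: (symA _ _ _ _ (symA _ _ _ _ IH)).
Qed.

Lemma run_arrived w m j om x y : w \in W2 -> (x, y) \in (run w m j om).2 ->
  x \in arrived w m j.
Proof.
move=> wW2 xy; rewrite -(perm_mem (perm_run m j om wW2)) mem_cat.
by apply/orP; right; apply/mapP; exists (x, y).
Qed.

Lemma run_functional w m j om x y y' : w \in W2 ->
  (x, y) \in (run w m j om).2 -> (x, y') \in (run w m j om).2 -> y = y'.
Proof.
move=> wW2; have : uniq (unzip1 (run w m j om).2).
  have := uniq_arrived w m j; rewrite -(perm_uniq (perm_run m j om wW2)).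
  by rewrite cat_uniq => /and3P[].
elim: (run w m j om).2 => // -[a b] E IH /= /andP[aE /IH {}IH].
have notin z : (a, z) \notin E.
  by apply: contra aE => az; apply/mapP; exists (a, z).
rewrite !inE => /orP[/eqP[-> ->]|xy] /orP[/eqP[]|xy'].
- by move=> ->.
- by rewrite (negbTE (notin _)) in xy'.
- by move=> xa _; rewrite xa (negbTE (notin _)) in xy.
- exact: IH.
Qed.

Lemma run_total w m j om x : w \in W2 -> (run w m j om).1 = [::] ->
  x \in arrived w m j -> exists y, (x, y) \in (run w m j om).2.
Proof.
move=> wW2 q0; rewrite -(perm_mem (perm_run m j om wW2)) /footprint q0 /=.
by move=> /mapP[[a b] ab /= ->]; exists b.
Qed.

(** The edges created before the buffer empties at m + j only involve items
    that have arrived by then. *)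
Lemma run_restart w m (j : nat) (m0 : int) om e : w \in W2 ->
  (run w m j om).1 = [::] -> m + j%:Z <= m0 -> arrivals_from m0 e.1 ->
  (exists i, e \in (run w m i om).2) <->
  (exists i, e \in (run [::] (m + j%:Z) i om).2).
Proof.
move=> wW2 q0 jm0 e1.
have old : e \notin (run w m j om).2.
  apply/negP; case: e e1 => x y /= e1 /(run_arrived wW2).
  by rewrite mem_arrived; case: x e1 => [p|[t b]] //=; lia.
split=> -[i ei]; last by exists (j + i)%N; rewrite (run_split i q0) mem_cat ei.
exists i; have : e \in (run w m (j + i) om).2 by apply: run_mono ei; lia.
by rewrite (run_split i q0) mem_cat (negbTE old) orbF.
Qed.

End Runs.

(** * Enumeration of a set of integers *)

(** Every integer has a next and a previous element of [A]; they are iterated from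
    an arbitrary element. *)
Lemma enumeration_exists (A : set int) :
  (forall m : int, exists2 a : int, a <= m & A a) ->
  (forall m : int, exists2 a : int, m < a & A a) ->
  exists c : int -> int, [/\ forall i, A (c i), forall i, c i < c (i + 1) &
    forall i a, A a -> c i < a -> c (i + 1) <= a].
Proof.
move=> below above.
have /choice[next nextP] : forall m : int, exists y : int,
    [/\ A y, m < y & forall a : int, A a -> m < a -> y <= a].
  move=> m; have : exists n : nat, `[< A (m + n.+1%:Z) >].
    have [a ma Aa] := above m; exists `|(a - m - 1)%R|%N; apply/asboolP.
    by rewrite (_ : m + _ = a)//; lia.
  move=> /ex_minnP[n /asboolP An min]; exists (m + n.+1%:Z); split=> //; first by lia.
  move=> a Aa ma; have := min `|(a - m - 1)%R|%N.
  rewrite (_ : m + _ = a); last by lia.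
  by move=> /(_ (asboolT Aa)); lia.
have /choice[prev prevP] : forall m : int, exists y : int,
    [/\ A y, y < m & forall a : int, A a -> a < m -> a <= y].
  move=> m; have : exists n : nat, `[< A (m - n.+1%:Z) >].
    have [a ma Aa] := below (m - 1); exists `|(m - a - 1)%R|%N; apply/asboolP.
    by rewrite (_ : m - _ = a)//; lia.
  move=> /ex_minnP[n /asboolP An min]; exists (m - n.+1%:Z); split=> //; first by lia.
  move=> a Aa ma; have := min `|(m - a - 1)%R|%N.
  rewrite (_ : m - _ = a); last by lia.
  by move=> /(_ (asboolT Aa)); lia.
have [a0 _ Aa0] := below 0.
pose c (i : int) := match i with
  | Posz n => iter n next a0 | Negz n => iter n.+1 prev a0 end.
have Ac i : A (c i).
  by case: i => -[|n] //=; [have [] := nextP (iter n next a0)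
    |have [] := prevP a0|have [] := prevP (iter n.+1 prev a0)].
have succ i : c i < c (i + 1) /\ forall a : int, A a -> c i < a -> c (i + 1) <= a.
  case: i => n; first by rewrite -PoszD addn1; have [] := nextP (iter n next a0).
  have -> : c (Negz n + 1) = iter n prev a0.
    by case: n => // n; rewrite (_ : Negz n.+1 + 1 = Negz n)//; lia.
  have [_ lt lub] := prevP (iter n prev a0); split => // a Aa.
  by rewrite leNgt /= => pa; apply/negP => /(lub a Aa); rewrite leNgt pa.
by exists c; split=> // i; have [] := succ i.
Qed.

Section Enumeration.
Context (c : int -> int) (c_lt : forall i, c i < c (i + 1)).

Lemma increasing_ge i (n : nat) : c i + n%:Z <= c (i + n%:Z).
Proof.
elim: n => [|n IH]; first by rewrite !addr0.
rewrite (_ : i + n.+1%:Z = i + n%:Z + 1); last by lia.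
have := c_lt (i + n%:Z); lia.
Qed.

Lemma increasing_homo : {homo c : i j / i < j}.
Proof.
move=> i j ij; have := increasing_ge i `|(j - i)%R|%N.
rewrite (_ : i + _ = j); lia.
Qed.

Lemma increasing_locate (m : int) : exists i, c i <= m < c (i + 1).
Proof.
have [i cim] : exists i, c i <= m.
  have [n nm] : exists n : nat, c 0 <= m + n%:Z.
    by exists `|(c 0 - m)%R|%N; lia.
  exists (- n%:Z); have := increasing_ge (- n%:Z) n.
  by rewrite addNr => h; rewrite -(lerD2r n%:Z); exact: le_trans h nm.
have : exists n : nat, m < c (i + n%:Z + 1).
  exists `|(m - c i)%R|%N; have := increasing_ge i `|(m - c i)%R|%N.
  by have := c_lt (i + `|(m - c i)%R|%N%:Z); lia.
move=> /ex_minnP[n mn min]; exists (i + n%:Z); rewrite mn andbT.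
case: n mn min => [|n] mn min; first by rewrite addr0.
rewrite leNgt; apply/negP => lt; have := min n.
by rewrite -addrA -PoszD addn1 lt => /(_ isT); lia.
Qed.

End Enumeration.

(** * The bi-infinite matching *)

Section LimitMatching.
Context {R : realType} {G : cgraph} (phi : policy R G).
Implicit Types (om : Omega G) (w : seq G) (m c t a : int) (x y : item).

Local Notation feed := (feed phi).
Local Notation run := (run phi).
Local Notation CP om := (construction_points (limit_word phi) om).

Definition limit_matching om : matching :=
  Matching arrivals
    [set e | exists2 a, CP om a & exists k, e \in (run [::] a k om).2].

Lemma eq_matching (M M' : matching) : nodes M = nodes M' ->
  (forall e, edges M e <-> edges M' e) -> M = M'.
Proof.
case: M M' => [N E] [N' E'] /= -> h; congr Matching.
by apply/seteqP; split=> e; apply h.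
Qed.

Lemma eq_restrict m (M M' : matching) :
  nodes M `&` arrivals_from m = nodes M' `&` arrivals_from m ->
  (forall e, arrivals_from m e.1 -> edges M e <-> edges M' e) ->
  restrict m M = restrict m M'.
Proof.
move=> hN hE; apply: eq_matching; first exact: hN.
move=> e; split=> -[Ee [e1 e2]]; have [h h'] := hE e e1.
  by split; [exact: h|split].
by split; [exact: h'|split].
Qed.

Section Coalescent.
Context (om : Omega G) (co : coalescent phi om).

Lemma run_CP a (j : nat) : CP om a -> CP om (a + j%:Z) ->
  (run [::] a j om).1 = [::].
Proof.
rewrite /construction_points /= => ha hj; apply: run_nil.
by rewrite -[X in feed X _]ha -(limit_word_feed _ _ co).
Qed.

(** The runs started from earlier construction points are empty at c, and those
    started from later ones are continuations of the run started at c. *)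
Lemma limit_edge c e : CP om c -> arrivals_from c e.1 ->
  edges (limit_matching om) e <-> exists i, e \in (run [::] c i om).2.
Proof.
move=> hc e1; split=> [/= [a ha [k ek]]|[i ei]]; last first.
  by exists c => //; exists i.
have [ac|ca] := leP a c.
  have cE : c = a + `|c - a|%N%:Z by lia.
  have q0 : (run [::] a `|c - a|%N om).1 = [::] by apply: run_CP => //; rewrite -cE.
  have := run_restart (m0 := c) (nil_W2 : [::] \in @W2 G) q0.
  rewrite -cE => /(_ e (lexx _) e1) [+ _]; apply; by exists k.
have aE : a = c + `|a - c|%N%:Z by lia.
have q0 : (run [::] c `|a - c|%N om).1 = [::] by apply: run_CP => //; rewrite -aE.
by exists (`|a - c|%N + k)%N; rewrite (run_split k q0) -aE mem_cat ek.
Qed.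

(** Let c be a time before m0 at which the run from [Y] and the one from the
    empty word are both empty.  Beyond c, both matchings consist of the edges
    that are created by the run restarted at c from the empty word. *)
Lemma limit_matching_past (Y : Omega G -> seq G) : Y2oo Y ->
  past_limit (fun m => matching_oo phi Y m om) (limit_matching om).
Proof.
move=> [r _ [_ Yr]] m0; have [c [cm0 [K hK]]] := co r m0.
have hc : CP om c.
  rewrite /construction_points /= -[c]addr0 (@limit_word_from _ _ _ _ _ K 0)//.
  by move=> k Kk; apply: hK => //; exact: nil_W2le.
exists (K + `|c|%N)%N => // k /= Kk.
set w := Y (shift (- k%:Z) om); have wr : w \in W2le r by exact: Yr.
pose j := `|(c + k%:Z)%R|%N; have cE : c = - k%:Z + j%:Z by rewrite /j; lia.
have q0 : (run w (- k%:Z) j om).1 = [::].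
  apply: run_nil; rewrite (@arr_eq _ _ (c - j%:Z)); last by rewrite /j; lia.
  by apply: hK => //; rewrite /j; lia.
apply: eq_restrict.
  apply/seteqP; split=> -[p|[t b]] [] //= h1 h2; split=> //.
    by exists (t, b).
  exists `|(t + k%:Z + 1)%R|%N => //=; lia.
move=> e e1.
have e1c : arrivals_from c e.1.
  by move: e1; case: (e.1) => [//|[t b]] /=; exact: le_trans.
rewrite (limit_edge hc e1c).
have := run_restart (W2le_W2 wr) q0 (_ : _ <= m0) e1; rewrite -cE => /(_ cm0) <-.
rewrite /matching_oo /=; split=> [[i _ /=]|[i ei]].
  by exists `|(- k%:Z + i%:Z - - k%:Z)%R|%N.
by exists i => //=; rewrite (_ : `|_|%N = i)//; lia.
Qed.

Lemma limit_matching_stationary (c : int -> int) :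
  enumerates c (CP om) -> (forall i, c i < c (i + 1)) ->
  limit_matching om = stationary_matching phi c om.
Proof.
move=> [_ rc] clt; have cCP i : CP om (c i) by rewrite -rc; exists i.
apply: eq_matching.
  apply/seteqP; split=> -[p|[t b]] /=.
  - by case.
  - by move=> _; have [i hi] := increasing_locate clt t; exists i.
  - by move=> [i _].
  - by move=> _; exists (t, b).
move=> e; split=> [[a + [k ek]]|[i _ /= ei]]; last first.
  by exists (c i) => //; exists `|(c (i + 1) - c i)%R|%N.
rewrite -rc => -[i _ ai]; rewrite -{}ai in ek.
have {ek} : e \in (run [::] (c i) `|(c (i + k%:Z) - c i)%R|%N om).2.
  by apply: run_mono ek; have := increasing_ge clt i k; lia.
elim: k => [|k IH]; first by rewrite addr0 subrr.
have ge_ := increasing_ge clt i k; have lt_ := clt (i + k%:Z).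
pose d := `|(c (i + k%:Z) - c i)%R|%N.
pose d' := `|(c (i + k%:Z + 1) - c (i + k%:Z))%R|%N.
have kE : i + k.+1%:Z = i + k%:Z + 1 by lia.
have -> : `|(c (i + k.+1%:Z) - c i)%R|%N = (d + d')%N by rewrite kE /d /d'; lia.
have dE : c i + d%:Z = c (i + k%:Z) by rewrite /d; lia.
have q0 : (run [::] (c i) d om).1 = [::] by apply: run_CP => //; rewrite dE.
rewrite (run_split d' q0) dE /= mem_cat => /orP[h|/IH//].
by exists (i + k%:Z).
Qed.

Hypothesis rec : recurrent phi om.

Lemma limit_matching_perfect : perfect (limit_matching om).
Proof.
move=> x [[t b] _ <-{x}].
have [a at_ ha] := construction_point_before t co.
have [a' ta' ha'] := construction_point_after t co rec.
have a'E : a' = a + `|a' - a|%N%:Z by lia.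
have q0 : (run [::] a `|a' - a|%N om).1 = [::] by apply: run_CP => //; rewrite -a'E.
have edge_a y : edges (limit_matching om) (inr (t, b), y) <->
    exists i, (inr (t, b), y) \in (run [::] a i om).2 by exact: limit_edge.
have [|y hy] := run_total (nil_W2 : [::] \in @W2 G) q0 (x := inr (t, b)).
  by rewrite mem_arrived -a'E at_.
exists y; split; first by apply/edge_a; exists `|a' - a|%N.
move=> y' /edge_a[i hi]; pose k := maxn `|a' - a|%N i.
apply: (run_functional (nil_W2 : [::] \in @W2 G) (om := om) (m := a) (j := k)).
  by apply: run_mono hy; exact: leq_maxl.
by apply: run_mono hi; exact: leq_maxr.
Qed.

Lemma construction_points_enumeration : exists c : int -> int,
  enumerates c (CP om) /\ forall i, c i < c (i + 1).
Proof.
have [|m|c [Ac clt succ]] := @enumeration_exists (CP om).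
- by move=> m; exact: construction_point_before.
- exact: construction_point_after.
exists c; split=> //; split; first exact: increasing_homo.
apply/seteqP; split=> [_ [i _ <-]//|a Aa].
have [i /andP[cia aci]] := increasing_locate clt a; exists i => //.
apply/eqP; rewrite eq_le cia leNgt /=; apply/negP => /(succ i a Aa).
by rewrite leNgt aci.
Qed.

End Coalescent.
End LimitMatching.

Lemma past_limit_unique (F : int -> matching) (M M' : matching) :
  nodes M = arrivals -> edges M `<=` arrivals `*` arrivals ->
  nodes M' = arrivals -> edges M' `<=` arrivals `*` arrivals ->
  past_limit F M -> past_limit F M' -> M = M'.
Proof.
move=> nM eM nM' eM' hM hM'; apply: eq_matching; first by rewrite nM nM'.
have restr m : restrict m M = restrict m M'.
  have [k _ hk] := hM m; have [k' _ hk'] := hM' m.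
  by rewrite -(hk (maxn k k')) ?hk'//= ?leq_maxl ?leq_maxr.
have sub (N N' : matching) : (forall m, restrict m N = restrict m N') ->
    edges N `<=` arrivals `*` arrivals -> edges N `<=` edges N'.
  move=> NN' sN [x y] xy; have [] := sN _ xy.
  move=> /= [[t b] _ xE] [[u d] _ yE].
  have : edges (restrict (Num.min t u) N) (x, y).
    by split=> //; split; rewrite -?xE -?yE /= ge_min lexx ?orbT.
  by rewrite NN' => -[].
by move=> e; split; apply: sub.
Qed.

Theorem theorem2 (R : realType) (G : cgraph) (phi : policy R G)
    (mu : distr R G) (mu_full : forall v : G, 0 < mu v)
    (P : probability (Omega G) R) (P_law : product_law phi mu P)
    (phi_sub : sub_additive phi)
    (tau1_int : forall Y : Omega G -> seq G, Y2oo Y ->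
      P.-integrable setT (tau1 phi Y)) :
  exists M : Omega G -> matching,
    [/\ biinfinite_matching phi P M /\ {ae P, forall om, perfect (M om)},
        forall M' : Omega G -> matching,
          biinfinite_matching phi P M' ->
          {ae P, forall om, perfect (M' om)} ->
          {ae P, forall om, M' om = M om},
        exists U : Omega G -> seq G,
          [/\ stationary_solution phi P U,
              forall U' : Omega G -> seq G, stationary_solution phi P U' ->
                {ae P, forall om, U' om = U om}
            & {ae P, forall om, exists2 c : int -> int,
                enumerates c (construction_points U om)
                & M om = stationary_matching phi c om}]
      & forall Y : Omega G -> seq G, Y2oo Y ->
          {ae P, forall om, past_limit (fun m => matching_oo phi Y m om) (M om)}].
Proof.
have co : {ae P, forall om, coalescent phi om}.
  exact (ae_coalescent mu_full P_law tau1_int).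
have rec : {ae P, forall om, recurrent phi om}.
  exact: ae_recurrent P_law tau1_int.
have edgesM om : edges (limit_matching phi om) `<=` arrivals `*` arrivals.
  move=> [x y] [a _ [k xy]].
  have arr_item z : z \in arrived [::] a k -> arrivals z.
    by rewrite mem_arrived; case: z => // u _; exists u.
  split; apply: arr_item; first exact: run_arrived nil_W2 xy.
  exact: run_arrived nil_W2 (run_sym xy).
have past Y : Y2oo Y -> {ae P, forall om,
    past_limit (fun m => matching_oo phi Y m om) (limit_matching phi om)}.
  by move=> hY; apply: filterS co => om co; exact: limit_matching_past.
exists (limit_matching phi); split=> //; first split.
- exists (fun=> [::] : seq G); first exact: W2_Y2oo nil_W2.
  have := past _ (W2_Y2oo nil_W2); apply: filterS => om h; split=> //.
- by apply: filterS2 co rec => om co rec; exact: limit_matching_perfect.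
- move=> M' [Y hY hM'] _; move: hM' (past _ hY); apply: filterS2.
  move=> om [nM' eM' limM'] limM.
  exact: past_limit_unique nM' eM' _ (edgesM om) limM' limM.
- exists (limit_word phi); split.
  + exact: limit_word_stationary co.
  + by move=> U'; apply: stationary_unique P_law co _.
  + apply: filterS2 co rec => om co rec.
    have [c [enum_c c_lt]] := construction_points_enumeration co rec.
    by exists c => //; exact: limit_matching_stationary.
Qed.
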